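(* Every generic achronal topological circle of $\mathrm{Ein}_2$ is the boundary (in $\mathrm{AdS}\cup\mathrm{Ein}_2$) of a smooth spacelike hypersurface of $\mathrm{AdS}$.
   Context: Let $E=\mathbb R^4$ with $Q=-u^2-v^2+x_1^2+x_2^2$, $\mathrm{AdS}=\{Q=-1\}$ with the induced Lorentzian metric, identified with $\{[x]\in S(E):Q(x)<0\}$, where $S(E)$ is the space of rays of $E$; its boundary in $S(E)$ is $\mathrm{Ein}_2=\{[x]:Q(x)=0\}$. Let $\mathbb D^2=\{p\in S^2:p_3>0\}$ and $d$ the spherical distance. The map $\overline{\mathbb D}^2\times\mathbb R\to S(E)$, $(p,\theta)\mapsto[(\cos\theta,\sin\theta,p_1,p_2)]$ identifies $\mathbb D^2\times\mathbb R$ with the universal covering of $\mathrm{AdS}$ (metric conformal to $ds^2-d\theta^2$) and $\partial\mathbb D^2\times\mathbb R$ with the infinite cyclic covering $\widehat{\mathrm{Ein}}_2$ of $\mathrm{Ein}_2$. An achronal topological circle in $\mathrm{Ein}_2$ is the projection of the graph in $\widehat{\mathrm{Ein}}_2$ of a $1$-Lipschitz map $f:\partial\mathbb D^2\to\mathbb R$. It is pure lightlike if the graph contains two opposite points, i.e. of the form $(x,\theta),(-x,\theta+\pi)$ (the graph is then contained in the past lightcone of one and the future lightcone of the other); otherwise it is generic. The boundary of a hypersurface of $\mathrm{AdS}$ is the intersection of its closure in $\mathrm{AdS}\cup\mathrm{Ein}_2$ with $\mathrm{Ein}_2$. A hypersurface is spacelike if all its nonzero tangent vectors have positive norm. *)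

(* Defs.v *)
From HB Require Import structures.
From mathcomp Require Import all_boot all_order all_algebra.
From mathcomp Require Import all_classical all_reals all_analysis.

Set Implicit Arguments.
Unset Strict Implicit.
Unset Printing Implicit Defensive.

Import Order.TTheory GRing.Theory Num.Theory.
Import numFieldNormedType.Exports.

Local Open Scope classical_set_scope.
Local Open Scope ring_scope.
Local Open Scope quotient_scope.

Section Smooth.
Context {R : realType}.

(* Class C^k of f on an open set U: f is C^(k+1) when it is differentiable on U
   and x |-> 'D_v f x is C^k for each fixed v, that is, in finite dimension,
   when x |-> 'd f x is C^k. *)
Fixpoint class_C (V W : normedModType R) (U : set V) (k : nat) (f : V -> W)
    : Prop :=
  match k with
  | 0 => forall x, U x -> {for x, continuous f}
  | k'.+1 => (forall x, U x -> differentiable f x) /\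
             (forall v, class_C U k' (fun x => 'D_v f x))
  end.

Definition smooth_on (V W : normedModType R) (U : set V) (f : V -> W) : Prop :=
  forall k, class_C U k f.

(* Embedded smooth submanifold of codimension m: near each of its points, M is
   the common zero set of m smooth functions whose differentials are linearly
   independent. *)
Definition submanifold (V : normedModType R) (m : nat) (M : set V) : Prop :=
  forall p, M p ->
  exists (U : set V) (g : 'I_m -> V -> R),
    [/\ open U /\ U p,
        forall i, smooth_on U (g i),
        M `&` U = [set x | U x /\ forall i, g i x = 0] &
        forall x, M x -> U x -> forall c : 'I_m -> R,
          (forall v, \sum_(i < m) c i * 'd (g i) x v = 0) ->
          forall i, c i = 0].

(* v is the velocity at p of a smooth curve drawn on M *)
Definition tangent (V : normedModType R) (M : set V) (p v : V) : Prop :=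
  exists (gamma : R -> V) (e : R),
    [/\ 0 < e,
        smooth_on `]- e, e[ gamma,
        forall t, t \in `]- e, e[ -> M (gamma t),
        gamma 0 = p &
        'D_1 gamma 0 = v].

End Smooth.

Section AntiDeSitter.
Variable R : realType.

(* coordinates (u, v, x_1, x_2) *)
Local Notation E := 'rV[R]_4.

Definition Q (x : E) : R :=
  - x 0 0 ^+ 2 - x 0 1 ^+ 2 + x 0 2 ^+ 2 + x 0 3 ^+ 2.

Definition AdS : set E := [set x | Q x = -1].

Definition nonzero : set E := [set x | x != 0].

Definition same_ray (x y : nonzero) : bool :=
  `[< exists2 t : R, 0 < t & val y = t *: val x >].

Lemma same_ray_equiv : equiv_class_of same_ray.
Proof.
split.
- by move=> x; apply/asboolP; exists 1; rewrite ?scale1r.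
- have sym x y : same_ray x y -> same_ray y x.
    move=> /asboolP[t t0 yE]; apply/asboolP; exists t^-1; first by rewrite invr_gt0.
    by rewrite yE scalerA mulVf ?scale1r// gt_eqF.
  by move=> x y; apply/idP/idP; exact: sym.
- move=> y x z /asboolP[t t0 yE] /asboolP[s s0 zE]; apply/asboolP.
  by exists (s * t); [exact: mulr_gt0 | rewrite zE yE scalerA].
Qed.

Canonical same_ray_equiv_rel := EquivRelPack same_ray_equiv.

(* S(E), with the quotient topology of E \ {0} *)
Definition rays := quotient_topology {eq_quot same_ray_equiv_rel}.

HB.instance Definition _ := Topological.on rays.

(* the rays spanned by the nonzero elements of A *)
Definition rays_of (A : set E) : set rays :=
  [set \pi_rays x | x in [set x : nonzero | A (val x)]].

Definition AdS_rays : set rays := rays_of [set x | Q x < 0].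

Definition Ein2 : set rays := rays_of [set x | Q x = 0].

(* S, a subset of {Q = -1}, is seen in S(E) through x |-> [x] *)
Definition ideal_boundary (S : set E) : set rays :=
  (closure (rays_of S) `&` (AdS_rays `|` Ein2)) `&` Ein2.

Definition spacelike (S : set E) : Prop :=
  forall p v, S p -> tangent S p v -> v != 0 -> 0 < Q v.

(* Hypersurfaces are connected, and closed in AdS (equivalently in E, since AdS
   is closed in E).  Were the edges of S not controlled by closedness, every
   nonempty closed subset of Ein2 would be the ideal boundary of small spacelike
   discs, joined by thin spacelike strips, that accumulate on it. *)
Definition hypersurface (S : set E) : Prop :=
  [/\ S `<=` AdS, submanifold 2 S, closed S & connected S].

Definition dot (p q : 'rV[R]_3) : R := \sum_(i < 3) p 0 i * q 0 i.

Definition sphere2 : set 'rV[R]_3 := [set p | dot p p = 1].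

Definition sphere_dist (p q : 'rV[R]_3) : R := acos (dot p q).

(* boundary of the open hemisphere p_3 > 0 *)
Definition bdisc : set 'rV[R]_3 := [set p | sphere2 p /\ p 0 2 = 0].

Definition cover_vec (z : 'rV[R]_3 * R) : E :=
  \row_(i < 4) [:: cos z.2; sin z.2; z.1 0 0; z.1 0 1]`_i.

Definition lipschitz1 (f : 'rV[R]_3 -> R) : Prop :=
  forall p q, bdisc p -> bdisc q -> `|f p - f q| <= sphere_dist p q.

(* only the values of f on bdisc matter *)
Definition graph (f : 'rV[R]_3 -> R) : set ('rV[R]_3 * R) :=
  [set z | bdisc z.1 /\ z.2 = f z.1].

(* L is the projection to Ein2 of the graph of f *)
Definition circle_of (f : 'rV[R]_3 -> R) : set rays :=
  rays_of (cover_vec @` graph f).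

Definition achronal_circle (L : set rays) : Prop :=
  exists2 f, lipschitz1 f & L = circle_of f.

Definition pure_lightlike (L : set rays) : Prop :=
  exists f, [/\ lipschitz1 f, L = circle_of f &
    exists x theta, graph f (x, theta) /\ graph f (- x, theta + pi)].

Definition generic_achronal_circle (L : set rays) : Prop :=
  achronal_circle L /\ ~ pure_lightlike L.

End AntiDeSitter.

(* Main.v *)
(* Let phi : R -> R lift the circle to the line, and let d be the spherical
   distance.  On the set Omega of points y of AdS that are spacelike related to
   every point xi(t) of the circle, tau_t = (cot (b / 2) - cot (a / 2)) / 2 has
   future timelike gradient, where a, b = d(p, x_t) +- (theta - phi(t)) in the
   coordinates (p, theta) of y: it is increasing in both null coordinates a, -b.
   It is also the quotient of two linear forms of y.  Hence
   T = int (tau_t + tau_t^3) dt is smooth, with timelike gradient, and {T = 0} is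
   spacelike.  On the vertical line over p, Omega is the interval
   max (phi - d) < theta < min (phi + d): the strict triangle inequality makes it
   nonempty, except when phi jumps by pi between antipodal points, which
   genericity excludes.  On it T increases from -oo to +oo, since the cubic term
   is not integrable at a point where a or b vanishes on the boundary of the
   interval (a and b are Lipschitz in t); so {T = 0} is the graph of a continuous
   function of p.  Its ideal points z satisfy <z, xi(t)> <= 0 for all t, which for
   z null forces z to be proportional to some xi(t). *)

Require Import Defs.
From HB Require Import structures.
From mathcomp Require Import all_boot all_order all_algebra.
From mathcomp Require Import all_classical all_reals all_analysis.
From mathcomp Require Import ring lra.

Set Implicit Arguments.
Unset Strict Implicit.
Unset Printing Implicit Defensive.

Import Order.TTheory GRing.Theory Num.Theory.
Import numFieldNormedType.Exports.

Local Open Scope classical_set_scope.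
Local Open Scope ring_scope.

(** * Smooth functions *)

Section Differentials.
Context {R : realType}.
Implicit Types V W : normedModType R.

(** A quadratic remainder is o(h), and the bound on [L] gives the continuity that a differential
    must have in an arbitrary normed space. The sign of [c] being unknown, the estimates use
    [|c| + 1]. *)
Lemma is_diff_quadratic V W (f L : V -> W) (x : V) (c d : R) :
  linear L -> 0 < d ->
  (forall h, `|L h| <= c * `|h|) ->
  (forall h, `|h| <= d -> `|f (x + h) - f x - L h| <= c * `|h| ^+ 2) ->
  is_diff x f L.
Proof.
move=> linL d0 Lc fL.
pose L' : {linear V -> W} := HB.pack L (GRing.isLinear.Build _ _ _ _ L linL).
have c0 : 0 < `|c| + 1 by rewrite ltr_wpDl.
have Lb : forall h, `|L h| <= (`|c| + 1) * `|h|.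
  move=> h; apply: le_trans (Lc h) _; rewrite ler_wpM2r//.
  by rewrite (le_trans (ler_norm _))// lerDl.
have contL : continuous L'.
  apply: bounded_linear_continuous; apply/linear_boundedP.
  exists (`|c| + 1); split; first exact: num_real.
  move=> M cM y; apply: (le_trans (Lb y)); rewrite ler_wpM2r//; exact: ltW.
have dfE : f \o shift x = cst (f x) + L' +o_ 0 id.
  apply/eqaddoP => _/posnumP[e]; near=> h.
  rewrite /= !fctE /= opprD addrA [h + x]addrC.
  have hd : `|h| <= d.
    by near: h; exact: (@nbhs0_le R V d d0).
  apply: (le_trans (fL _ hd)); rewrite expr2 mulrA ler_wpM2r//.
  have he : `|h| <= e%:num / (`|c| + 1).
    by near: h; apply: (@nbhs0_le R V _); rewrite divr_gt0.
  apply: (@le_trans _ _ ((`|c| + 1) * `|h|)).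
    by rewrite ler_wpM2r// (le_trans (ler_norm _))// lerDl.
  by rewrite mulrC -ler_pdivlMr.
have dE := diff_unique contL dfE.
apply: DiffDef => //.
by apply/diff_locallyP; rewrite dE; split.
Unshelve. all: by end_near. Qed.

Lemma near_eq_is_diff V W (f g df : V -> W) (x : V) :
  {near x, f =1 g} -> is_diff x f df -> is_diff x g df.
Proof.
move=> fg fdf.
have [dc fE] := (diff_locallyP x f).1 (@ex_diff _ _ _ _ _ _ _ fdf).
have gE : g \o shift x = cst (g x) + 'd f x +o_ 0 id.
  apply/eqaddoP => e e0.
  move/eqaddoP : fE => /(_ e e0); apply: filter_app.
  have : \forall h \near 0, f (h + x) = g (h + x).
    have := fg; rewrite [X in X -> _](near_shift 0) /= subr0.
    by apply: filterS => h.
  apply: filterS => h fgh.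
  by rewrite /= !fctE /= fgh (nbhs_singleton fg).
have dE := diff_unique dc gE.
apply: DiffDef; first by apply/diff_locallyP; rewrite dE.
by rewrite dE; exact: diff_val.
Qed.

Lemma class_C_ext V W (U : set V) k (f g : V -> W) : open U ->
  (forall x, U x -> f x = g x) -> class_C U k f -> class_C U k g.
Proof.
move=> oU; elim: k f g => [|k IH] f g fg /=.
  move=> cf x Ux; have := cf x Ux.
  have fgn : {near x, f =1 g}.
    by apply: filterS (open_nbhs_nbhs (conj oU Ux)) => y Uy; exact: fg.
  move=> fx; change (g @ x --> g x); rewrite -(fg x Ux).
  exact: cvg_trans (near_eq_cvg fgn) fx.
have fgn x : U x -> \near x, f x = g x.
  by move=> Ux; apply: filterS (open_nbhs_nbhs (conj oU Ux)) => y Uy; exact: fg.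
move=> [df cf]; split.
  move=> x Ux; have := differentiableP (df x Ux).
  by move=> /(near_eq_is_diff (fgn x Ux)) [].
move=> v; apply: IH (cf v) => x Ux.
exact: near_eq_derive (fgn x Ux).
Qed.

Lemma class_C_cst V W (U : set V) k (c : W) : class_C U k (cst c : V -> W).
Proof.
elim: k c => [|k IH] c /=; first by move=> x _; exact: cst_continuous.
split=> [x _|v]; first exact: differentiable_cst.
by rewrite (_ : (fun x => _) = cst 0)//; apply/funext => x; exact: derive_cst.
Qed.

Lemma class_CD V W (U : set V) k (f g : V -> W) : open U ->
  class_C U k f -> class_C U k g -> class_C U k (f + g).
Proof.
move=> oU; elim: k f g => [|k IH] f g /=.
  by move=> cf cg x Ux; apply: continuousD; [exact: cf|exact: cg].
move=> [df cf] [dg cg]; split.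
  by move=> x Ux; apply: differentiableD; [exact: df|exact: dg].
(* The sum rule for derivatives holds only on [U], where both terms are differentiable. *)
move=> v; apply: class_C_ext (IH _ _ (cf v) (cg v)) => // x Ux /=.
by rewrite deriveD//; apply: diff_derivable; [exact: df|exact: dg].
Qed.

Lemma class_C_linear V W (U : set V) k (f : V -> W) :
  (forall x, is_diff x f f) -> class_C U k f.
Proof.
move=> df; case: k => [|k] /=.
  by move=> x _; exact: differentiable_continuous.
split=> // v.
rewrite (_ : (fun x => _) = cst (f v)); first exact: class_C_cst.
by apply/funext => x; rewrite deriveE// diff_val.
Qed.

End Differentials.

(** * Integrals of continuous functions over a segment *)

Section Integral.
Context {R : realType}.
Implicit Types (g : R -> R) (l : R).

Definition itg l g : R := \int[lebesgue_measure]_(t in `[0, l]) g t.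

Definition cont_on (l : R) (g : R -> R) : Prop := {within `[0, l], continuous g}.

Lemma cont_on_int l g : cont_on l g ->
  lebesgue_measure.-integrable `[0, l] (EFin \o g).
Proof. by apply: continuous_compact_integrable; exact: segment_compact. Qed.

Lemma itgD l g1 g2 : cont_on l g1 -> cont_on l g2 ->
  itg l (fun t => g1 t + g2 t) = itg l g1 + itg l g2.
Proof. by move=> c1 c2; apply: RintegralD => //; exact: cont_on_int. Qed.

Lemma itgB l g1 g2 : cont_on l g1 -> cont_on l g2 ->
  itg l (fun t => g1 t - g2 t) = itg l g1 - itg l g2.
Proof. by move=> c1 c2; apply: RintegralB => //; exact: cont_on_int. Qed.

Lemma itgZ l k g : cont_on l g -> itg l (fun t => k * g t) = k * itg l g.
Proof. by move=> c; apply: RintegralZl => //; exact: cont_on_int. Qed.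

Lemma cont_on_cst l c : cont_on l (cst c).
Proof. by move=> ?; exact: cvg_cst. Qed.

Lemma itg_cst l c : 0 <= l -> itg l (cst c) = c * l.
Proof.
move=> l0; rewrite /itg Rintegral_cst//= lebesgue_measure_itv/= lte_fin.
by case: ltgtP l0 => //= [l0|<-] _; rewrite ?subr0//= mulr0.
Qed.

Lemma le_itg l g1 g2 : cont_on l g1 -> cont_on l g2 ->
  (forall t, 0 <= t <= l -> g1 t <= g2 t) -> itg l g1 <= itg l g2.
Proof.
move=> c1 c2 le12; apply: le_Rintegral => //; [exact: cont_on_int c1|exact: cont_on_int c2].
Qed.

Lemma norm_itg_le l g M : 0 <= l -> cont_on l g ->
  (forall t, 0 <= t <= l -> `|g t| <= M) -> `|itg l g| <= M * l.
Proof.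
move=> l0 cg gM; rewrite -itg_cst// ler_norml; apply/andP; split.
  rewrite itg_cst// -mulNr -itg_cst//; apply: le_itg => //; first exact: cont_on_cst.
  by move=> t /gM /=; rewrite ler_norml => /andP[].
apply: le_itg => //; first exact: cont_on_cst.
by move=> t /gM /=; rewrite ler_norml => /andP[].
Qed.

Lemma cont_on_bounded l g : 0 <= l -> cont_on l g ->
  exists2 M, 0 < M & forall t, 0 <= t <= l -> `|g t| <= M.
Proof.
move=> l0 cg.
have [x _ gx] := EVT_max l0 cg; have [y _ gy] := EVT_min l0 cg.
exists (`|g x| + `|g y| + 1); first by rewrite ltr_wpDl// addr_ge0.
move=> t tl; have {}tl : t \in `[0, l] by rewrite in_itv.
have := gx t tl; have := gy t tl.
have := ler_norm (g x); have := ler_norm (- g y); rewrite normrN.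
have := normr_ge0 (g x); have := normr_ge0 (g y).
by move=> *; rewrite ler_norml; lra.
Qed.

Lemma cont_on_pos l g : 0 <= l -> cont_on l g ->
  (forall t, 0 <= t <= l -> 0 < g t) ->
  exists2 k, 0 < k & forall t, 0 <= t <= l -> k <= g t.
Proof.
move=> l0 cg g0; have [y yl gy] := EVT_min l0 cg.
exists (g y); first by apply: g0; rewrite in_itv in yl.
by move=> t tl; apply: gy; rewrite in_itv.
Qed.

Lemma itg_gt0 l g : 0 < l -> cont_on l g ->
  (forall t, 0 <= t <= l -> 0 < g t) -> 0 < itg l g.
Proof.
move=> l0 cg /(cont_on_pos (ltW l0) cg)[k k0 kg].
apply: (@lt_le_trans _ _ (itg l (cst k))); first by rewrite itg_cst ?mulr_gt0// ltW.
by apply: le_itg => //; exact: cont_on_cst.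
Qed.

Lemma lt_itg l g1 g2 : 0 < l -> cont_on l g1 -> cont_on l g2 ->
  (forall t, 0 <= t <= l -> g1 t < g2 t) -> itg l g1 < itg l g2.
Proof.
move=> l0 c1 c2 lt12; rewrite -subr_gt0 -itgB//; apply: itg_gt0 => //.
  by move=> x; apply: continuousB; [exact: c2|exact: c1].
by move=> t /lt12; rewrite subr_gt0.
Qed.

(** Once [m] is added the integrand is nonnegative, so restricting the integral to the window
    [[s, s + e]] only lowers it. This detects a tall narrow peak of the integrand. *)
Lemma itg_ge_bump l g s e m M : 0 <= s -> 0 <= e -> 0 <= m ->
  s + e <= l ->
  cont_on l g -> (forall t, 0 <= t <= l -> - m <= g t) ->
  (forall t, s <= t <= s + e -> M <= g t) ->
  M * e - m * l <= itg l g.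
Proof.
move=> s0 e0 m0 sl cg gm gM.
have l0 : 0 <= l by lra.
have cm : cont_on l (fun t => g t + m).
  by move=> x; apply: continuousD; [exact: cg|exact: cvg_cst].
have -> : itg l g = itg l (fun t => g t + m) - m * l.
  by rewrite itgD ?itg_cst// ?addrK//; exact: cont_on_cst.
rewrite lerD2r.
have sub : `[s, s + e] `<=` `[0, l].
  by move=> t /=; rewrite !in_itv/= => /andP[? ?]; apply/andP; split; lra.
have cs : {within `[s, s + e], continuous (fun t => g t + m)}.
  exact: continuous_subspaceW cm.
have its : lebesgue_measure.-integrable `[s, s + e] (EFin \o (fun t => g t + m)).
  by apply: continuous_compact_integrable => //; exact: segment_compact.
have itc : lebesgue_measure.-integrable `[s, s + e] (EFin \o cst (M + m)).
  apply: continuous_compact_integrable => //; first exact: segment_compact.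
  by move=> ?; exact: cvg_cst.
have gm0 t : `[0, l]%classic t -> 0 <= g t + m.
  by move=> /=; rewrite in_itv/= => /gm; lra.
apply: (@le_trans _ _ (\int[lebesgue_measure]_(t in `[s, s + e]) (g t + m))).
  apply: (@le_trans _ _ (\int[lebesgue_measure]_(t in `[s, s + e]) (cst (M + m) t))).
    rewrite Rintegral_cst//= lebesgue_measure_itv/= lte_fin.
    have := e0; rewrite le_eqVlt => /predU1P[<-|e1].
      by rewrite addr0 ltxx !mulr0.
    by rewrite ltrDl e1/=; nra.
  apply: le_Rintegral => // t /=; rewrite in_itv/= => /gM; lra.
rewrite fine_le//.
- exact: integrable_fin_num.
- exact: integrable_fin_num (cont_on_int cm).
apply: ge0_subset_integral => //=.
- by have /integrableP[] := cont_on_int cm.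
Qed.
End Integral.

Section ContOn.
Context {R : realType}.
Implicit Types (l : R) (f g : R -> R).

Lemma cont_onT l g : continuous g -> cont_on l g.
Proof. exact: continuous_subspaceT. Qed.

Lemma cont_onD l f g : cont_on l f -> cont_on l g -> cont_on l (fun t => f t + g t).
Proof. by move=> cf cg x; apply: continuousD; [exact: cf|exact: cg]. Qed.

Lemma cont_onN l g : cont_on l g -> cont_on l (fun t => - g t).
Proof. by move=> cg x; apply: continuousN; exact: cg. Qed.

Lemma cont_onM l f g : cont_on l f -> cont_on l g -> cont_on l (fun t => f t * g t).
Proof. by move=> cf cg x; apply: continuousM; [exact: cf|exact: cg]. Qed.

Lemma cont_onX l g n : cont_on l g -> cont_on l (fun t => g t ^+ n).
Proof.
move=> cg; elim: n => [|n IH].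
  by under eq_fun do rewrite expr0; exact: cont_on_cst.
by under eq_fun do rewrite exprS; exact: cont_onM.
Qed.

Lemma cont_onV l g : cont_on l g -> (forall t, 0 <= t <= l -> g t != 0) ->
  cont_on l (fun t => (g t)^-1).
Proof.
move=> cg g0; rewrite /cont_on continuous_subspace_in => x xl.
apply: (@continuousV R (subspace `[0, l])); last exact: cg.
by apply: g0; move: xl; rewrite inE /= in_itv.
Qed.

End ContOn.

(** * Differentiation under the integral sign *)

Section UniformlyDifferentiable.
Context {R : realType} {V : normedModType R}.
Variable l : R.
Implicit Types (g L : V -> R -> R) (y h : V).

(* the remainder is quadratic in h, uniformly in t *)
Definition unif_diff y g L := exists c d : R, 0 < d /\
  forall t, 0 <= t <= l ->
    [/\ `|g y t| <= c, forall h, `|L h t| <= c * `|h| &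
        forall h, `|h| <= d -> `|g (y + h) t - g y t - L h t| <= c * `|h| ^+ 2].

Lemma unif_diffM y g1 L1 g2 L2 :
  unif_diff y g1 L1 -> unif_diff y g2 L2 ->
  unif_diff y (fun z t => g1 z t * g2 z t)
              (fun h t => L1 h t * g2 y t + g1 y t * L2 h t).
Proof.
move=> [c1 [d1 [d10 H1]]] [c2 [d2 [d20 H2]]].
(* The remainder of the product splits into terms bounded by [c1 * c2], [3 * c1 * c2] and
   [2 * c1 * c2] times [|h| ^+ 2], which make up the first summand; the second one bounds the
   differential. A radius at most 1 gives [|h| ^+ 2 <= |h|]. *)
exists (6 * c1 * c2 + 2 * c1 * c2).
exists (Num.min 1 (Num.min d1 d2)); split; first by rewrite !lt_min d10 d20 ltr01.
move=> t tl; have [g1c L1c r1c] := H1 t tl; have [g2c L2c r2c] := H2 t tl.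
have c10 : 0 <= c1 by exact: le_trans (normr_ge0 _) g1c.
have c20 : 0 <= c2 by exact: le_trans (normr_ge0 _) g2c.
have c120 : 0 <= c1 * c2 by rewrite mulr_ge0.
split.
- rewrite normrM; apply: (@le_trans _ _ (c1 * c2)); first by rewrite ler_pM.
  by lra.
- move=> h; apply: (le_trans (ler_normD _ _)); rewrite !normrM.
  apply: (@le_trans _ _ (c1 * `|h| * c2 + c1 * (c2 * `|h|))).
    by apply: lerD; apply: ler_pM.
  by have := normr_ge0 h; nra.
move=> h; rewrite !le_min => /and3P[h1 hd1 hd2].
have := r1c h hd1; have := r2c h hd2; have := L1c h; have := L2c h.
set r1 := _ - L1 h t; set r2 := _ - L2 h t => l2 l1 hr2 hr1.
have -> : g1 (y + h) t = g1 y t + L1 h t + r1 by rewrite /r1; ring.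
have -> : g2 (y + h) t = g2 y t + L2 h t + r2 by rewrite /r2; ring.
have -> : (g1 y t + L1 h t + r1) * (g2 y t + L2 h t + r2) - g1 y t * g2 y t -
  (L1 h t * g2 y t + g1 y t * L2 h t) =
  L1 h t * L2 h t + r1 * (g2 y t + L2 h t + r2) + (g1 y t + L1 h t) * r2 by ring.
have h0 := normr_ge0 h.
have hh : `|h| ^+ 2 <= `|h| by rewrite expr2 ler_piMr.
have B2 : `|g2 y t + L2 h t + r2| <= 3 * c2.
  apply: (le_trans (ler_normD _ _)); apply: (@le_trans _ _ (c2 + c2 + c2)); last by lra.
  apply: lerD; last by apply: (le_trans hr2); nra.
  apply: (le_trans (ler_normD _ _)); apply: lerD => //; apply: (le_trans l2); nra.
have B1 : `|g1 y t + L1 h t| <= 2 * c1.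
  apply: (le_trans (ler_normD _ _)); apply: (@le_trans _ _ (c1 + c1)); last by lra.
  by apply: lerD => //; apply: (le_trans l1); nra.
apply: (le_trans (ler_normD _ _)).
apply: (@le_trans _ _ (c1 * `|h| * (c2 * `|h|) + c1 * `|h| ^+ 2 * (3 * c2) +
   2 * c1 * (c2 * `|h| ^+ 2))).
  apply: lerD; last by rewrite normrM; apply: ler_pM.
  apply: (le_trans (ler_normD _ _)); rewrite !normrM.
  by apply: lerD; apply: ler_pM.
have := sqr_ge0 `|h|; rewrite !expr2; nra.
Qed.

Lemma unif_diff_ext y g1 g2 L1 L2 :
  (forall z t, g1 z t = g2 z t) -> (forall h t, L1 h t = L2 h t) ->
  unif_diff y g1 L1 -> unif_diff y g2 L2.
Proof.
move=> gE LE [c [d [d0 H]]]; exists c, d; split => // t tl; have [gc Lc rc] := H t tl.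
by split=> [|h|h hd]; rewrite -?gE -?LE//; exact: rc.
Qed.

Lemma unif_diff_cst y (m : R -> R) : 0 <= l -> cont_on l m ->
  unif_diff y (fun _ t => m t) (fun _ _ => 0).
Proof.
move=> l0 /(cont_on_bounded l0)[c c0 mc].
exists c, 1; split => // t tl; split=> [|h|h _]; first exact: mc.
  by rewrite normr0 mulr_ge0// ltW.
by rewrite subrr subr0 normr0 mulr_ge0// ?sqr_ge0// ltW.
Qed.

Lemma unif_diff_linear y (a : R -> V -> R) (c : R) :
  (forall t, linear (a t)) -> (forall t v, 0 <= t <= l -> `|a t v| <= c * `|v|) ->
  unif_diff y (fun z t => a t z) (fun h t => a t h).
Proof.
move=> lina ac; have [c0|c0] := leP c 0.
  exists 0, 1; split=> // t tl.
  have a0 v : a t v = 0.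
    apply/eqP; rewrite -normr_le0; apply: (le_trans (ac t v tl)).
    by rewrite mulr_le0_ge0.
  by split=> [|h|h _]; rewrite !a0 ?subrr ?normr0 ?mul0r// subr0 normr0.
exists (c * `|y| + c), 1; split=> // t tl; split=> [|h|h _].
- by apply: (le_trans (ac t y tl)); rewrite lerDl ltW.
- by apply: (le_trans (ac t h tl)); rewrite ler_wpM2r// lerDr mulr_ge0// ltW.
have -> : a t (y + h) = a t y + a t h by have := lina t 1 y h; rewrite !scale1r.
rewrite addrAC addrK subrr normr0; apply: mulr_ge0 (sqr_ge0 _).
by apply: addr_ge0; [apply: mulr_ge0 => //|]; exact: ltW.
Qed.

(** A displacement of norm at most [k / 2 / c'] keeps the denominator above [k / 2]. With
    [u = b t y] and [w = b t h], the remainder is exactly [w ^+ 2 / ((u + w) * u ^+ 2)]. *)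
Lemma unif_diff_inv y (b : R -> V -> R) (c k : R) : 0 < k ->
  (forall t, linear (b t)) -> (forall t v, 0 <= t <= l -> `|b t v| <= c * `|v|) ->
  (forall t, 0 <= t <= l -> k <= b t y) ->
  unif_diff y (fun z t => (b t z)^-1) (fun h t => - b t h * (b t y) ^- 2).
Proof.
move=> k0 linb bc kb.
pose c' := `|c| + 1; have c'0 : 0 < c' by rewrite ltr_wpDl.
have {}bc t v : 0 <= t <= l -> `|b t v| <= c' * `|v|.
  move=> tl; apply: (le_trans (bc t v tl)); rewrite ler_wpM2r//.
  by rewrite (le_trans (ler_norm _))// lerDl.
exists (k^-1 + c' * k^-1 ^+ 2 + c' ^+ 2 * (2 * k^-1 ^+ 3)).
exists (k / 2 / c'); split; first by rewrite !divr_gt0.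
move=> t tl.
have by0 : 0 < b t y by rewrite (lt_le_trans k0)// kb.
have bV : (b t y)^-1 <= k^-1 by rewrite lef_pV2// ?posrE// kb.
have kV0 : 0 < k^-1 by rewrite invr_gt0.
have bV0 : 0 < (b t y)^-1 by rewrite invr_gt0.
have T1 : 0 <= c' * k^-1 ^+ 2 by rewrite mulr_ge0 ?sqr_ge0// ltW.
have T2 : 0 <= c' ^+ 2 * (2 * k^-1 ^+ 3).
  by rewrite mulr_ge0 ?sqr_ge0// mulr_ge0// exprn_ge0// ltW.
have bV2 : (b t y) ^- 2 <= k^-1 ^+ 2.
  by rewrite -exprVn lerXn2r// ?nnegrE ltW.
split=> [|h|h hd].
- by rewrite gtr0_norm//; lra.
- rewrite normrM normrN (@ger0_norm _ (b t y ^- 2)) ?invr_ge0 ?sqr_ge0//.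
  apply: (@le_trans _ _ (c' * `|h| * (k^-1 ^+ 2))).
    by apply: ler_pM => //; rewrite ?invr_ge0 ?sqr_ge0//; exact: bc.
  by rewrite mulrAC ler_wpM2r//; lra.
have bD : b t (y + h) = b t y + b t h by have := linb t 1 y h; rewrite !scale1r.
have bh : `|b t h| <= k / 2.
  apply: (le_trans (bc t h tl)); rewrite mulrC -ler_pdivlMr//.
have bh2 : k / 2 <= b t (y + h).
  rewrite bD; have := kb t tl; move: bh; rewrite ler_norml; lra.
have byh0 : 0 < b t (y + h) by rewrite (lt_le_trans _ bh2)// divr_gt0.
have -> : (b t (y + h))^-1 - (b t y)^-1 - - b t h * b t y ^- 2 =
   (b t h) ^+ 2 * ((b t (y + h))^-1 * b t y ^- 2).
  rewrite -exprVn; have : b t y != 0 by rewrite gt_eqF.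
  have := byh0; rewrite bD => /gt_eqF/negbT; move: (b t y) (b t h) => u w *.
  by field; apply/andP.
rewrite normrM ger0_norm ?sqr_ge0// ger0_norm; last first.
  by rewrite mulr_ge0 ?invr_ge0 ?sqr_ge0// ltW.
apply: (@le_trans _ _ ((c' * `|h|) ^+ 2 * (2 * k^-1 * k^-1 ^+ 2))).
  apply: ler_pM; first exact: sqr_ge0.
  - by apply: mulr_ge0; [rewrite invr_ge0 ltW|rewrite invr_ge0 sqr_ge0].
  - rewrite -(real_normK (num_real (b t h))) lerXn2r ?nnegrE ?mulr_ge0//.
    + exact: ltW.
    + exact: bc.
  apply: ler_pM => //; rewrite ?invr_ge0 ?sqr_ge0//; first exact: ltW.
  by rewrite -[2]invrK -invfM lef_pV2 ?posrE ?mulr_gt0// ?invr_gt0// mulrC.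
have -> : (c' * `|h|) ^+ 2 * (2 * k^-1 * k^-1 ^+ 2) =
  c' ^+ 2 * (2 * k^-1 ^+ 3) * `|h| ^+ 2 by ring.
by rewrite ler_wpM2r ?sqr_ge0//; lra.
Qed.

(** Uniformity in [t] lets the quadratic remainder be integrated: its constant is multiplied by [l],
    and [is_diff_quadratic] applies. *)
Lemma unif_diff_itg y g L (e : R) : 0 <= l -> 0 < e -> unif_diff y g L ->
  (forall h, `|h| <= e -> cont_on l (g (y + h))) ->
  (forall h, cont_on l (L h)) ->
  (forall t, linear (L ^~ t)) ->
  is_diff y (fun z => itg l (g z)) (fun h => itg l (L h)).
Proof.
move=> l0 e0 [c [d [d0 H]]] cg cL linL.
have cgy : cont_on l (g y) by rewrite -[y]addr0; apply: cg; rewrite normr0 ltW.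
apply: (@is_diff_quadratic _ _ _ _ _ _ (c * l) (Num.min d e)).
- move=> k u v; rewrite /GRing.scale/= -itgZ// -itgD//.
    by congr (itg l _); apply/funext => t; rewrite linL.
  by apply: cont_onM => //; exact: cont_on_cst.
- by rewrite lt_min d0.
- move=> h; rewrite mulrAC; apply: norm_itg_le => // t tl.
  by have [] := H t tl.
move=> h; rewrite le_min => /andP[hd he]; rewrite -!itgB//.
- rewrite mulrAC; apply: norm_itg_le => //.
    by do !apply: cont_onD => //; [exact: cg|exact: cont_onN|exact: cont_onN].
  by move=> t tl; have [_ _] := H t tl; exact.
- by apply: cont_onD; [exact: cg|exact: cont_onN].
- exact: cg.
Qed.

End UniformlyDifferentiable.

(** * Smoothness of integrals of quotients of linear forms *)

Section Kernel.
Context {R : realType} {V : normedModType R}.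
Variables (l c : R) (a b : R -> V -> R).
Hypothesis l0 : 0 <= l.
Hypotheses (lina : forall t, linear (a t)) (linb : forall t, linear (b t)).
Hypothesis ac : forall (t : R) v, 0 <= t <= l -> `|a t v| <= c * `|v|.
Hypothesis bc : forall (t : R) v, 0 <= t <= l -> `|b t v| <= c * `|v|.
Hypotheses (conta : forall v, cont_on l (a ^~ v)) (contb : forall v, cont_on l (b ^~ v)).

Definition pos_dom : set V := [set y | forall t : R, 0 <= t <= l -> 0 < b t y].

(** By compactness of [[0, l]] the denominators at [y] have a common positive lower bound, half of
    which survives a small displacement. *)
Lemma pos_dom_ball y : pos_dom y ->
  exists2 e, 0 < e & forall h, `|h| <= e -> pos_dom (y + h).
Proof.
move=> /(cont_on_pos l0 (@contb y))[k k0 kb].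
have c0 : 0 < `|c| + 1 by rewrite ltr_wpDl.
exists (k / 2 / (`|c| + 1)); first by rewrite !divr_gt0.
move=> h hd t tl; have -> : b t (y + h) = b t y + b t h.
  by have := linb t 1 y h; rewrite !scale1r.
suff : `|b t h| <= k / 2 by have := kb t tl; rewrite ler_norml; lra.
apply: (le_trans (bc h tl)); apply: (@le_trans _ _ ((`|c| + 1) * `|h|)).
  by rewrite ler_wpM2r// (le_trans (ler_norm _))// lerDl.
by rewrite mulrC -ler_pdivlMr.
Qed.

Lemma open_pos_dom : open pos_dom.
Proof.
rewrite openE => y /pos_dom_ball[e e0 He]; rewrite /interior.
apply/nbhs_normP; exists e => // z /=; rewrite distrC => ze.
by rewrite -[z](subrK y) addrC; apply: He; exact: ltW.
Qed.

(** Integrals of this form are closed, up to sums, under differentiation in [y]: a directional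
    derivative shifts the exponents and absorbs the direction into the weight [m]. Smoothness then
    follows by induction on the order. *)
Definition integrand (m : R -> R) (i n : nat) (y : V) (t : R) : R :=
  m t * a t y ^+ i * (b t y)^-1 ^+ n.

Definition integrand_itg m i n y : R := itg l (integrand m i n y).

Lemma cont_on_integrand m i n y : cont_on l m -> pos_dom y ->
  cont_on l (integrand m i n y).
Proof.
move=> cm yP; apply: cont_onM; last first.
  by apply: cont_onX; apply: cont_onV => // t /yP /gt_eqF/negbT.
by apply: cont_onM => //; exact: cont_onX.
Qed.

Lemma unif_diffX y (g L : V -> R -> R) i : unif_diff l y g L ->
  unif_diff l y (fun z t => g z t ^+ i) (fun h t => i%:R * g y t ^+ i.-1 * L h t).
Proof.
move=> gL; elim: i => [|i IH].
  have := unif_diff_cst y l0 (@cont_on_cst _ l 1).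
  by apply: unif_diff_ext => [z t|h t]; rewrite ?expr0// !mul0r.
have := unif_diffM gL IH; apply: unif_diff_ext => [z t|h t]; rewrite ?exprS//=.
case: i {IH} => [|i]; first by rewrite !expr0; ring.
by rewrite exprS -[in RHS]natr1 /=; ring.
Qed.

Lemma is_diff_integrand_itg m i n y : cont_on l m -> pos_dom y ->
  is_diff y (integrand_itg m i n)
    (fun h => integrand_itg (fun t => i%:R * a t h * m t) i.-1 n y +
              integrand_itg (fun t => - n%:R * b t h * m t) i n.+1 y).
Proof.
move=> cm yP.
have cca h : cont_on l (fun t => i%:R * a t h * m t).
  by apply: cont_onM => //; apply: cont_onM => //; exact: cont_on_cst.
have ccb h : cont_on l (fun t => - n%:R * b t h * m t).
  by apply: cont_onM => //; apply: cont_onM => //; exact: cont_on_cst.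
pose L h t := integrand (fun t => i%:R * a t h * m t) i.-1 n y t +
              integrand (fun t => - n%:R * b t h * m t) i n.+1 y t.
have -> : (fun h => integrand_itg (fun t => i%:R * a t h * m t) i.-1 n y +
     integrand_itg (fun t => - n%:R * b t h * m t) i n.+1 y) = (fun h => itg l (L h)).
  by apply/funext => h; rewrite itgD//; exact: cont_on_integrand.
have [e e0 He] := pos_dom_ball yP.
apply: (unif_diff_itg l0 e0).
- have [k k0 kb] := cont_on_pos l0 (@contb y) yP.
  have Hm := unif_diff_cst y l0 cm.
  have Ha := unif_diffX i (unif_diff_linear y lina ac).
  have Hb := unif_diffX n (unif_diff_inv k0 linb bc kb).
  have := unif_diffM (unif_diffM Hm Ha) Hb; apply: unif_diff_ext => // h t.
  rewrite /L /integrand mul0r add0r -exprVn; set X := (b t y)^-1.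
  (* The predecessor is truncated at 0, where the factor [n%:R] vanishes anyway. *)
  have E : n%:R * X ^+ n.-1 * X ^+ 2 = n%:R * X ^+ n.+1.
    case: (n) => [|n']; first by rewrite !mul0r.
    by rewrite /= !exprS; ring.
  transitivity (i%:R * a t h * m t * a t y ^+ i.-1 * X ^+ n
    - m t * a t y ^+ i * b t h * (n%:R * X ^+ n.-1 * X ^+ 2)); first by ring.
  by rewrite E; ring.
- by move=> h hd; apply: cont_on_integrand => //; exact: He.
- by move=> h; apply: cont_onD; exact: cont_on_integrand.
- move=> t k u v; rewrite /L /integrand lina linb /GRing.scale/=; ring.
Qed.

Lemma class_C_integrand_itg k m i n : cont_on l m ->
  class_C pos_dom k (integrand_itg m i n).
Proof.
elim: k m i n => [|k IH] m i n cm /=.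
  move=> y yP; apply: differentiable_continuous.
  by have := is_diff_integrand_itg i n cm yP => -[].
split; first by move=> y yP; have := is_diff_integrand_itg i n cm yP => -[].
move=> v.
have cca : cont_on l (fun t => i%:R * a t v * m t).
  by apply: cont_onM => //; apply: cont_onM => //; exact: cont_on_cst.
have ccb : cont_on l (fun t => - n%:R * b t v * m t).
  by apply: cont_onM => //; apply: cont_onM => //; exact: cont_on_cst.
apply: (class_C_ext _ _ (class_CD open_pos_dom (IH _ i.-1 n cca) (IH _ i n.+1 ccb))).
  exact: open_pos_dom.
move=> y yP /=; have dJ := is_diff_integrand_itg i n cm yP.
by rewrite deriveE ?diff_val.
Qed.

End Kernel.

(** * The inequality behind the growth of the time function along future causal vectors *)

Section LorentzAlgebra.
Context {R : realType}.
Implicit Types y w : 'rV[R]_4.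

Lemma ltr_abs_sqr (x z : R) : 0 <= z -> x ^+ 2 < z ^+ 2 -> - z < x < z.
Proof.
move=> z0; rewrite -[x ^+ 2](real_normK (num_real x)) ltr_sqr ?nnegrE//.
by rewrite ltr_norml.
Qed.

(** This is the sign of the derivative of a quotient of two linear forms along [w], for [y] in AdS
    and [w] a future causal vector tangent at [y]; [al] below measures how [w] rotates the [(u, v)]
    plane. In the frame of [(cf, sf)], the difference of the two sides times [r2] is [al * (r2 - p *
    q) + n * (r2 * k - rho * q)], and the first term dominates the second. *)
Lemma timelike_increase (y0 y1 y2 y3 w0 w1 w2 w3 cf sf ct st : R) :
  cf ^+ 2 + sf ^+ 2 = 1 -> ct ^+ 2 + st ^+ 2 = 1 ->
  y0 ^+ 2 + y1 ^+ 2 = 1 + y2 ^+ 2 + y3 ^+ 2 ->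
  y0 * w0 + y1 * w1 = y2 * w2 + y3 * w3 ->
  w2 ^+ 2 + w3 ^+ 2 <= w0 ^+ 2 + w1 ^+ 2 ->
  0 < y0 * w1 - y1 * w0 ->
  0 < y0 * cf + y1 * sf - y2 * ct - y3 * st ->
  (y1 * cf - y0 * sf) * (w0 * cf + w1 * sf - w2 * ct - w3 * st) <
  (w1 * cf - w0 * sf) * (y0 * cf + y1 * sf - y2 * ct - y3 * st).
Proof.
move=> F X Y W Qw al0 D0.
pose r2 := y0 ^+ 2 + y1 ^+ 2.
pose p := y0 * cf + y1 * sf; pose n := y1 * cf - y0 * sf.
pose q := y2 * ct + y3 * st; pose k := w2 * ct + w3 * st.
pose rho := y0 * w0 + y1 * w1; pose al := y0 * w1 - y1 * w0.
have r21 : 1 <= r2 by rewrite /r2 Y; have := sqr_ge0 y2; have := sqr_ge0 y3; lra.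
have pn : p ^+ 2 + n ^+ 2 = r2.
  transitivity (r2 * (cf ^+ 2 + sf ^+ 2)); first by rewrite /p /n /r2; ring.
  by rewrite F mulr1.
have Dpq : 0 < p - q by move: D0; rewrite /p /q; lra.
have q2 : q ^+ 2 <= r2 - 1.
  have -> : r2 - 1 = (y2 ^+ 2 + y3 ^+ 2) * (ct ^+ 2 + st ^+ 2).
    by rewrite X /r2 Y; ring.
  rewrite -subr_ge0; have -> : (y2 ^+ 2 + y3 ^+ 2) * (ct ^+ 2 + st ^+ 2) - q ^+ 2 =
    (y2 * st - y3 * ct) ^+ 2 by rewrite /q; ring.
  exact: sqr_ge0.
have pq_lt : 0 < r2 - p * q.
  have /(@ltr_abs_sqr (p * q) r2 _) : (p * q) ^+ 2 < r2 ^+ 2.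
    have := sqr_ge0 n; have := sqr_ge0 p; have := sqr_ge0 q.
    rewrite exprMn [r2 ^+ 2]expr2; nra.
  by move=> /(_ ltac:(lra)); lra.
(* Cauchy-Schwarz in the [(x_1, x_2)] plane, combined with [al2], where the causality of [w]
   enters. *)
have CS : (r2 * k - rho * q) ^+ 2 <= (r2 - q ^+ 2) * al ^+ 2.
  have al2 : r2 * (w2 ^+ 2 + w3 ^+ 2) - rho ^+ 2 <= al ^+ 2.
    have -> : al ^+ 2 = r2 * (w0 ^+ 2 + w1 ^+ 2) - rho ^+ 2.
      by rewrite /al /rho /r2; ring.
    by rewrite lerD2r ler_wpM2l//; lra.
  apply: (@le_trans _ _ ((r2 - q ^+ 2) * (r2 * (w2 ^+ 2 + w3 ^+ 2) - rho ^+ 2))).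
    rewrite -subr_ge0.
    have -> : (r2 - q ^+ 2) * (r2 * (w2 ^+ 2 + w3 ^+ 2) - rho ^+ 2) -
      (r2 * k - rho * q) ^+ 2 = r2 * (ct * w3 - st * w2) ^+ 2.
      transitivity ((r2 * (ct ^+ 2 + st ^+ 2) - q ^+ 2) *
        (r2 * (w2 ^+ 2 + w3 ^+ 2) - rho ^+ 2) - (r2 * k - rho * q) ^+ 2).
        by rewrite X mulr1.
      transitivity (r2 * (r2 - (y2 ^+ 2 + y3 ^+ 2)) * (ct * w3 - st * w2) ^+ 2).
        by rewrite /rho W /k /q; ring.
      by rewrite {2}/r2 Y; ring.
    by rewrite mulr_ge0 ?sqr_ge0//; lra.
  by rewrite ler_wpM2l//; lra.
(* By [CS] the comparison of squares reduces to [(r2 - p * q) ^+ 2 - n ^+ 2 * (r2 - q ^+ 2) = r2 *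
   (p - q) ^+ 2], which is positive. *)
have main : 0 < al * (r2 - p * q) + n * (r2 * k - rho * q).
  have : (n * (r2 * k - rho * q)) ^+ 2 < (al * (r2 - p * q)) ^+ 2.
    rewrite !exprMn; apply: (@le_lt_trans _ _ (n ^+ 2 * ((r2 - q ^+ 2) * al ^+ 2))).
      by rewrite ler_wpM2l ?sqr_ge0.
    rewrite -subr_gt0.
    have -> : al ^+ 2 * (r2 - p * q) ^+ 2 - n ^+ 2 * ((r2 - q ^+ 2) * al ^+ 2) =
      al ^+ 2 * (r2 * (p - q) ^+ 2) by rewrite -pn; ring.
    by rewrite !mulr_gt0 ?exprn_gt0//; lra.
  by move=> /ltr_abs_sqr; rewrite mulr_ge0 ?ltW// => /(_ isT); lra.
have : 0 < r2 * ((w1 * cf - w0 * sf) * (y0 * cf + y1 * sf - y2 * ct - y3 * st)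
     - (y1 * cf - y0 * sf) * (w0 * cf + w1 * sf - w2 * ct - w3 * st)).
  suff -> : r2 * ((w1 * cf - w0 * sf) * (y0 * cf + y1 * sf - y2 * ct - y3 * st)
     - (y1 * cf - y0 * sf) * (w0 * cf + w1 * sf - w2 * ct - w3 * st)) =
     al * (r2 - p * q) + n * (r2 * k - rho * q) by [].
  transitivity (al * (p ^+ 2 + n ^+ 2 - p * q) + n * (r2 * k - rho * q)).
    by rewrite /al /p /n /q /k /rho /r2; ring.
  by rewrite pn.
rewrite pmulr_rgt0; last by lra.
by rewrite subr_gt0.
Qed.

End LorentzAlgebra.

(** * The time function *)

Section Vec4.
Context {R : realType}.
Implicit Types y w : 'rV[R]_4.

Definition vec4 (a b c d : R) : 'rV[R]_4 := \row_(i < 4) [:: a; b; c; d]`_i.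

Lemma vec4E0 a b c d : vec4 a b c d 0 0 = a. Proof. by rewrite mxE. Qed.
Lemma vec4E1 a b c d : vec4 a b c d 0 1 = b. Proof. by rewrite mxE. Qed.
Lemma vec4E2 a b c d : vec4 a b c d 0 2 = c. Proof. by rewrite mxE. Qed.
Lemma vec4E3 a b c d : vec4 a b c d 0 3 = d. Proof. by rewrite mxE. Qed.
Definition vec4E := (vec4E0, vec4E1, vec4E2, vec4E3).

Lemma forall_ord4 (P : 'I_4 -> Prop) : P 0 -> P 1 -> P 2 -> P 3 -> forall i, P i.
Proof.
move=> P0 P1 P2 P3 [[|[|[|[|//]]]] i4].
- by have -> : Ordinal i4 = 0 by exact: val_inj.
- by have -> : Ordinal i4 = 1 by exact: val_inj.
- by have -> : Ordinal i4 = 2 by exact: val_inj.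
- by have -> : Ordinal i4 = 3 by exact: val_inj.
Qed.

Lemma rV4P y w : y 0 0 = w 0 0 -> y 0 1 = w 0 1 -> y 0 2 = w 0 2 ->
  y 0 3 = w 0 3 -> y = w.
Proof.
by move=> *; apply/matrixP => i; rewrite (ord1 i); exact: forall_ord4.
Qed.

Lemma coord_le_norm m n (y : 'M[R]_(m.+1, n.+1)) i j : `|y i j| <= `|y|.
Proof.
rewrite /Num.norm/= mx_normrE.
exact: (le_bigmax _ (fun k : 'I_m.+1 * 'I_n.+1 => `|y k.1 k.2|) (i, j)).
Qed.

End Vec4.

Section TimeFunction.
Context {R : realType}.
Variable phi : R -> R.
Hypothesis contphi : continuous phi.
Implicit Types y w : 'rV[R]_4.

(** A length above [2 * pi] lets [t] run over the whole circle; covering a part of it twice is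
    harmless. *)
Local Notation l := (9 : R).

(* With xi t = (cos (phi t), sin (phi t), cos t, sin t), the boundary point over
   t, tden t y is minus the scalar product of y and xi t, and tnum t y / tden t y is
   (cot (b / 2) - cot (a / 2)) / 2, where a and b are the sum and the difference
   of the spherical distance and of the time difference between y and xi t. *)
Definition tnum (t : R) y : R := y 0 1 * cos (phi t) - y 0 0 * sin (phi t).
Definition tden (t : R) y : R :=
  y 0 0 * cos (phi t) + y 0 1 * sin (phi t) - y 0 2 * cos t - y 0 3 * sin t.

Lemma linear_num t : linear (tnum t).
Proof. by move=> k u v; rewrite /tnum !mxE /GRing.scale/=; ring. Qed.

Lemma linear_den t : linear (tden t).
Proof. by move=> k u v; rewrite /tden !mxE /GRing.scale/=; ring. Qed.

Lemma norm_mul_le1 (x m s : R) : `|x| <= m -> `|s| <= 1 -> `|x * s| <= m.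
Proof.
by move=> xm s1; rewrite normrM -[m]mulr1; apply: ler_pM.
Qed.

Lemma num_le t y : `|tnum t y| <= 4 * `|y|.
Proof.
have h0 := norm_mul_le1 (coord_le_norm y 0 0) (sin_max (phi t)).
have h1 := norm_mul_le1 (coord_le_norm y 0 1) (cos_max (phi t)).
have := normr_ge0 y; move: h0 h1; rewrite /tnum !ler_norml; lra.
Qed.

Lemma den_le t y : `|tden t y| <= 4 * `|y|.
Proof.
have h0 := norm_mul_le1 (coord_le_norm y 0 0) (cos_max (phi t)).
have h1 := norm_mul_le1 (coord_le_norm y 0 1) (sin_max (phi t)).
have h2 := norm_mul_le1 (coord_le_norm y 0 2) (cos_max t).
have h3 := norm_mul_le1 (coord_le_norm y 0 3) (sin_max t).
have := normr_ge0 y; move: h0 h1 h2 h3; rewrite /tden !ler_norml; lra.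
Qed.

Lemma continuous_cosphi : continuous (fun t => cos (phi t)).
Proof. by move=> t; apply: continuous_comp; [exact: contphi|exact: continuous_cos]. Qed.

Lemma continuous_sinphi : continuous (fun t => sin (phi t)).
Proof. by move=> t; apply: continuous_comp; [exact: contphi|exact: continuous_sin]. Qed.

Lemma continuous_num y : continuous (tnum ^~ y).
Proof.
move=> t; rewrite /tnum; apply: cvgB; apply: cvgM; try exact: cvg_cst.
  exact: continuous_cosphi.
exact: continuous_sinphi.
Qed.

Lemma continuous_den y : continuous (tden ^~ y).
Proof.
move=> t; rewrite /tden; apply: cvgB; first apply: cvgB; first apply: cvgD;
  apply: cvgM; try exact: cvg_cst.
- exact: continuous_cosphi.
- exact: continuous_sinphi.
- exact: continuous_cos.
- exact: continuous_sin.
Qed.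

Definition Omega : set 'rV[R]_4 := pos_dom l tden.

Definition tau t y := tnum t y / tden t y.

(** The summands are the integrals of [tau] and of its cube, written as members of the family
    [integrand_itg] so that smoothness and the differential are inherited from it. *)
Definition time y : R :=
  integrand_itg l tnum tden (cst 1) 1 1 y + integrand_itg l tnum tden (cst 1) 3 3 y.

Definition dtau t y w :=
  (tnum t w * tden t y - tnum t y * tden t w) / tden t y ^+ 2.

Lemma cont_num y : cont_on l (tnum ^~ y). Proof. exact: cont_onT (@continuous_num y). Qed.
Lemma cont_den y : cont_on l (tden ^~ y). Proof. exact: cont_onT (@continuous_den y). Qed.

Lemma nine_ge0 : 0 <= l. Proof. by []. Qed.

Lemma open_Omega : open Omega.
Proof.
exact: (open_pos_dom nine_ge0 linear_den (fun t v _ => den_le t v) cont_den).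
Qed.

Lemma cont_tau y : Omega y -> cont_on l (tau ^~ y).
Proof.
move=> yO; apply: cont_onM; first exact: cont_num.
by apply: cont_onV => [|t /yO/gt_eqF/negbT//]; exact: cont_den.
Qed.

Lemma cont_dtau y w : Omega y -> cont_on l (fun t => dtau t y w).
Proof.
move=> yO; apply: cont_onM.
  apply: cont_onD; first by apply: cont_onM; [exact: cont_num|exact: cont_den].
  by apply: cont_onN; apply: cont_onM; [exact: cont_num|exact: cont_den].
apply: cont_onV; first by apply: cont_onX; exact: cont_den.
by move=> t /yO/gt_eqF/negbT ?; rewrite expf_neq0.
Qed.

Lemma timeE y : Omega y -> time y = itg l (fun t => tau t y + tau t y ^+ 3).
Proof.
move=> yO; rewrite /time /integrand_itg -itgD.
- congr itg; apply/funext => t; by rewrite /integrand /tau /cst; ring.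
- by apply: cont_on_integrand => //; [exact: cont_num|exact: cont_den|exact: cont_on_cst].
- by apply: cont_on_integrand => //; [exact: cont_num|exact: cont_den|exact: cont_on_cst].
Qed.

Lemma is_diff_time y : Omega y ->
  is_diff y time (fun w => itg l (fun t => (1 + 3 * tau t y ^+ 2) * dtau t y w)).
Proof.
move=> yO.
have D i n := is_diff_integrand_itg nine_ge0 linear_num linear_den
  (fun t v _ => num_le t v) (fun t v _ => den_le t v) cont_num cont_den i n
  (@cont_on_cst _ l 1) yO.
have := is_diffD (D 1%N 1%N) (D 3 3); rewrite [X in is_diff _ X _](_ : _ = time)//.
move=> dt; apply: is_diff_eq dt _; apply/funext => w.
have cm i n v : cont_on l (integrand tnum tden
    (fun t => i%:R * tnum t v * cst 1 t) i.-1 n y).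
  apply: cont_on_integrand => //; [exact: cont_num|exact: cont_den|].
  by do !apply: cont_onM; do ?exact: cont_on_cst; exact: cont_num.
have cm' i n v : cont_on l (integrand tnum tden
    (fun t => - n%:R * tden t v * cst 1 t) i n.+1 y).
  apply: cont_on_integrand => //; [exact: cont_num|exact: cont_den|].
  by do !apply: cont_onM; do ?exact: cont_on_cst; exact: cont_den.
rewrite !fctE /integrand_itg -!itgD//; last first.
  exact: cont_onD.
  exact: cont_onD.
rewrite /itg; apply: eq_Rintegral => t; rewrite inE/= in_itv/= => /yO/gt_eqF/negbT d0.
by rewrite /integrand /tau /dtau /=; field.
Qed.

Lemma class_C_time k : class_C Omega k time.
Proof.
have C i n := @class_C_integrand_itg _ _ _ _ _ _ nine_ge0 linear_num linear_den
  (fun t v _ => num_le t v) (fun t v _ => den_le t v) cont_num cont_den k (cst 1) i n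
  (@cont_on_cst _ l 1).
exact: (class_CD open_Omega (C 1%N 1%N) (C 3 3)).
Qed.

Definition lorentz y w : R :=
  - y 0 0 * w 0 0 - y 0 1 * w 0 1 + y 0 2 * w 0 2 + y 0 3 * w 0 3.

(** The last hypothesis orients [w] to the future: the angle of [(u, v)] increases along it. Each
    [dtau] is then positive by [timelike_increase], and so is its factor [1 + 3 * tau ^+ 2]. *)
Lemma time_future y w : Omega y -> Q y = -1 -> lorentz y w = 0 -> Q w <= 0 ->
  0 < y 0 0 * w 0 1 - y 0 1 * w 0 0 -> 0 < 'd time y w.
Proof.
move=> yO Qy yw Qw fut; have dt := is_diff_time yO.
rewrite diff_val; apply: itg_gt0 => //.
  apply: cont_onM; last exact: cont_dtau.
  apply: cont_onD; first exact: cont_on_cst.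
  by apply: cont_onM; [exact: cont_on_cst|apply: cont_onX; exact: cont_tau].
move=> t tl; have d0 : 0 < tden t y := yO t tl.
apply: mulr_gt0; first by rewrite ltr_wpDr// mulr_ge0// sqr_ge0.
rewrite divr_gt0 ?exprn_gt0// subr_gt0.
move: Qy yw Qw; rewrite /Q /lorentz => Qy yw Qw.
by apply: timelike_increase => //; rewrite ?cos2Dsin2//; lra.
Qed.

End TimeFunction.

(** * The fibres of the time function *)

Section Trigonometry.
Context {R : realType}.
Implicit Types x y t s u v : R.

Lemma sin_lipschitz x y : `|sin x - sin y| <= `|x - y|.
Proof.
wlog xy : x y / x <= y => [H|].
  have [/H//|/ltW /H] := leP x y.
  by rewrite distrC [leRHS]distrC.
have [|c _ cE] := @MVT_segment R sin cos x y xy.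
  by apply: continuous_subspaceT; exact: continuous_sin.
rewrite distrC [leRHS]distrC cE normrM -[leRHS]mul1r ler_wpM2r//.
exact: cos_max.
Qed.

Lemma cos_lipschitz x y : `|cos x - cos y| <= `|x - y|.
Proof.
by rewrite -!sinDpihalf (le_trans (sin_lipschitz _ _))// opprD addrACA subrr addr0.
Qed.

Lemma polar u v : u ^+ 2 + v ^+ 2 = 1 ->
  exists x, [/\ `|x| <= pi, cos x = u & sin x = v].
Proof.
move=> uv.
have u1 : -1 <= u <= 1.
  by rewrite -ler_norml -[leRHS]normr1 -ler_sqr ?nnegrE// !real_normK ?num_real//
    expr1n -uv lerDl sqr_ge0.
have u1' : u \in `[(-1), 1] by rewrite in_itv.
have sv : sin (acos u) = `|v|.
  by rewrite sin_acos// -uv [u ^+ 2 + _]addrC addrK sqrtr_sqr.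
have ap : `|acos u| <= pi by rewrite ger0_norm ?acos_lepi// acos_ge0.
have [v0|v0] := leP 0 v.
  by exists (acos u); split => //; [exact: acosK|rewrite sv ger0_norm].
exists (- acos u); split; first by rewrite normrN.
  by rewrite cosN acosK.
by rewrite sinN sv ltr0_norm ?opprK.
Qed.

Lemma acos_cos_le x : acos (cos x) <= `|x|.
Proof.
have [xp|xp] := leP `|x| pi.
  by rewrite -(cos_norm x) cosK// in_itv/= normr_ge0.
apply: le_trans (ltW xp); apply: acos_lepi.
by rewrite cos_geN1 cos_le1.
Qed.

Lemma acos_lt (c d : R) : -1 <= c <= 1 -> 0 <= d <= pi -> cos d < c -> acos c < d.
Proof.
move=> c1 d0 dc; rewrite -ltr_cos ?in_itv//= ?acosK ?in_itv//.
by rewrite acos_ge0 ?acos_lepi.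
Qed.

(** With [u = m - e] and [v = m + e], the cross-multiplied difference is
    [2 * sin e * (cos e - c * cos m)]. Through [tau_cov] this becomes the monotonicity of [tau]
    along a fibre. *)
Lemma sin_ratio_increasing (c d u v : R) : 0 < d < pi -> cos d = c ->
  - d < u -> u < v -> v < d ->
  sin u / (cos u - c) < sin v / (cos v - c).
Proof.
move=> /andP[d0 dpi] dc du uv vd.
have cos_gt w : - d < w < d -> 0 < cos w - c.
  rewrite -ltr_norml => wd; rewrite subr_gt0 -dc -(cos_norm w) ltr_cos ?in_itv//=.
    by rewrite normr_ge0 (ltW (lt_trans wd dpi)).
  by rewrite !ltW.
have cu : 0 < cos u - c by apply: cos_gt; lra.
have cv : 0 < cos v - c by apply: cos_gt; lra.
rewrite ltr_pdivrMr// mulrAC ltr_pdivlMr//.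
pose m := (u + v) / 2; pose e := (v - u) / 2.
have -> : u = m - e by rewrite /m /e; lra.
have -> : v = m + e by rewrite /m /e; lra.
have e0 : 0 < e by rewrite /e; lra.
have Me : `|m| + e < d.
  by rewrite -ltrBrDr ltr_norml /m /e; apply/andP; split; lra.
have c1 : -1 < c < 1.
  rewrite -dc; apply/andP; split.
    by rewrite -cospi ltr_cos ?in_itv//= ?lexx ?pi_ge0 ?ltW.
  by rewrite -cos0 ltr_cos ?in_itv//= ?lexx ?pi_ge0 ?ltW.
have M0 := normr_ge0 m.
have sine : 0 < sin e by apply: sin_gt0_pi; apply/andP; split; lra.
suff key : c * cos m < cos e.
  rewrite -subr_gt0 cosB cosD sinB sinD.
  have -> : (sin m * cos e + cos m * sin e) * (cos m * cos e + sin m * sin e - c) -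
    (sin m * cos e - cos m * sin e) * (cos m * cos e - sin m * sin e - c) =
    2 * sin e * (cos e * (cos m ^+ 2 + sin m ^+ 2) - c * cos m) by ring.
  by rewrite cos2Dsin2 mulr1 !mulr_gt0// subr_gt0.
(* From [M + e < d] comes [c < cos (M + e)]. If [cos M < 0], then [-1 < c] and [e < pi - M]
   conclude; otherwise the expansion of [cos e] as the cosine of [(M + e) - M] does. *)
rewrite -(cos_norm m); set M := `|m| in M0 Me *.
have cMe : c < cos (M + e).
  by rewrite -dc ltr_cos ?in_itv//=; first [lra | by apply/andP; split; lra].
have [cM|cM] := leP 0 (cos M); last first.
  have : - cos M < cos e.
    have -> : - cos M = cos (pi - M) by rewrite cosB cospi sinpi; ring.
    by rewrite ltr_cos ?in_itv//=; first [lra | by apply/andP; split; lra].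
  by nra.
have -> : cos e = cos (M + e) * cos M + sin (M + e) * sin M.
  by rewrite -cosB; congr cos; ring.
have sMe : 0 < sin (M + e) by apply: sin_gt0_pi; apply/andP; split; lra.
have sM : 0 <= sin M by apply: sin_ge0_pi; apply/andP; split; lra.
have := cM; rewrite le_eqVlt => /predU1P[cM0|cM0].
  have sM1 : 0 < sin M.
    rewrite lt0r sM andbT; apply/eqP => sM0.
    by have := cos2Dsin2 M; rewrite -cM0 sM0; lra.
  by rewrite -cM0 !mulr0 add0r mulr_gt0.
have := mulr_ge0 (ltW sMe) sM; nra.
Qed.

End Trigonometry.

(** * Coordinates on AdS and distances in the hemisphere *)

Section Fiber.
Context {R : realType}.
Implicit Types (a b t s x : R).

Definition ads_radius a b : R := Num.sqrt (1 + a ^+ 2 + b ^+ 2).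

Lemma radius_arg_gt0 a b : 0 < 1 + a ^+ 2 + b ^+ 2.
Proof. by rewrite -addrA ltr_pwDl// addr_ge0 ?sqr_ge0. Qed.

Lemma radius_gt0 a b : 0 < ads_radius a b.
Proof. by rewrite sqrtr_gt0 radius_arg_gt0. Qed.

Lemma sqr_radius a b : ads_radius a b ^+ 2 = 1 + a ^+ 2 + b ^+ 2.
Proof. by rewrite sqr_sqrtr// ltW// radius_arg_gt0. Qed.

(** In the universal covering this point has time [x] and, after division by [ads_radius a b], lies
    over the hemisphere point proportional to [(a, b, 1)]. *)
Definition cov a b x : 'rV[R]_4 := vec4 (ads_radius a b * cos x) (ads_radius a b * sin x) a b.

Lemma Q_cov a b x : Q (cov a b x) = -1.
Proof.
rewrite /Q /cov !vec4E.
transitivity (- (ads_radius a b ^+ 2 * (cos x ^+ 2 + sin x ^+ 2)) + a ^+ 2 + b ^+ 2);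
  first by ring.
by rewrite cos2Dsin2 sqr_radius; ring.
Qed.

Lemma AdS_cov (y : 'rV[R]_4) : Q y = -1 -> exists x, y = cov (y 0 2) (y 0 3) x.
Proof.
rewrite /Q => Qy; set r := ads_radius (y 0 2) (y 0 3).
have r0 : r != 0 by rewrite gt_eqF// radius_gt0.
have [|x [_ cx sx]] := @polar R (y 0 0 / r) (y 0 1 / r).
  rewrite !expr_div_n -mulrDl sqr_radius.
  have -> : y 0 0 ^+ 2 + y 0 1 ^+ 2 = 1 + y 0 2 ^+ 2 + y 0 3 ^+ 2 by lra.
  by rewrite divff// gt_eqF// radius_arg_gt0.
exists x; apply: rV4P; rewrite /cov !vec4E//.
  by rewrite cx -/r mulrC divfK.
by rewrite sx -/r mulrC divfK.
Qed.

(** Scalar product of the hemisphere point proportional to [(a, b, 1)] with the boundary point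
    [(cos t, sin t, 0)], that is, the cosine of their spherical distance. *)
Definition cosdist a b t : R := (a * cos t + b * sin t) / ads_radius a b.

Lemma sqr_combo_le a b t : (a * cos t + b * sin t) ^+ 2 <= a ^+ 2 + b ^+ 2.
Proof.
rewrite -subr_ge0.
have -> : a ^+ 2 + b ^+ 2 - (a * cos t + b * sin t) ^+ 2 =
   (a ^+ 2 + b ^+ 2) * (1 - (cos t ^+ 2 + sin t ^+ 2)) + (a * sin t - b * cos t) ^+ 2.
  by ring.
by rewrite cos2Dsin2 subrr mulr0 add0r sqr_ge0.
Qed.

Lemma cosdist_itv a b t : -1 < cosdist a b t < 1.
Proof.
have := @ltr_abs_sqr _ (cosdist a b t) 1 ler01; apply.
rewrite expr1n /cosdist expr_div_n ltr_pdivrMr ?exprn_gt0 ?radius_gt0//.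
by rewrite mul1r sqr_radius; have := sqr_combo_le a b t; lra.
Qed.

Lemma cosdist_itvW a b t : -1 <= cosdist a b t <= 1.
Proof. by have /andP[/ltW-> /ltW->] := cosdist_itv a b t. Qed.

Definition bdist a b t : R := acos (cosdist a b t).

Lemma cos_bdist a b t : cos (bdist a b t) = cosdist a b t.
Proof. by rewrite acosK// in_itv/= cosdist_itvW. Qed.

Lemma bdist_itv a b t : 0 < bdist a b t < pi.
Proof.
have /andP[c1 c2] := cosdist_itv a b t.
by rewrite acos_gt0 ?acos_ltpi ?c1 ?c2 ?ltW.
Qed.

Lemma continuous_cosdist a b : continuous (cosdist a b).
Proof.
move=> t; apply: cvgM; last exact: cvg_cst.
by apply: cvgD; apply: cvgM; try exact: cvg_cst;
  [exact: continuous_cos|exact: continuous_sin].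
Qed.

Lemma continuous_bdist a b : continuous (bdist a b).
Proof.
move=> t; apply: (@continuous_comp _ _ _ (cosdist a b)); first exact: continuous_cosdist.
exact/continuous_acos/cosdist_itv.
Qed.

(* the triangle inequality for a path from s to t through an interior point of
   the hemisphere is strict unless s and t are antipodal *)
Lemma bdist_triangle a b s t : bdist a b s + bdist a b t < pi ->
  acos (cos (s - t)) < bdist a b s + bdist a b t.
Proof.
have /andP[ds0 dspi] := bdist_itv a b s; have /andP[dt0 dtpi] := bdist_itv a b t.
move=> dpi; apply: acos_lt; first by rewrite cos_geN1 cos_le1.
  by apply/andP; split; lra.
set ds := bdist a b s in ds0 dspi dpi *; set dt := bdist a b t in dt0 dtpi dpi *.
have r0 := radius_gt0 a b; set r := ads_radius a b in r0.
have cds : r * cos ds = a * cos s + b * sin s.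
  by rewrite cos_bdist /cosdist mulrC divfK// gt_eqF.
have cdt : r * cos dt = a * cos t + b * sin t.
  by rewrite cos_bdist /cosdist mulrC divfK// gt_eqF.
have ss : 0 < sin ds by rewrite sin_gt0_pi// ds0.
have st : 0 < sin dt by rewrite sin_gt0_pi// dt0.
pose X := cos (s - t) - cos ds * cos dt.
(* Both sides are the Gram determinant of three unit vectors: the hemisphere point, at height
   [1 / r], and the two boundary points at angles [s] and [t]. *)
have XE : (sin ds * sin dt) ^+ 2 - X ^+ 2 = sin (s - t) ^+ 2 / r ^+ 2.
  apply: (@mulfI _ (r ^+ 4)); first by rewrite expf_neq0// gt_eqF.
  have -> : r ^+ 4 * (sin (s - t) ^+ 2 / r ^+ 2) = r ^+ 2 * sin (s - t) ^+ 2.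
    by field; rewrite gt_eqF.
  have -> : r ^+ 4 * ((sin ds * sin dt) ^+ 2 - X ^+ 2) =
     (r ^+ 2 - (r * cos ds) ^+ 2) * (r ^+ 2 - (r * cos dt) ^+ 2) -
     (r ^+ 2 * cos (s - t) - (r * cos ds) * (r * cos dt)) ^+ 2.
    by rewrite exprMn !sin2cos2 /X; ring.
  rewrite cds cdt.
  have r2 : r ^+ 2 = 1 + (a ^+ 2 + b ^+ 2) by rewrite sqr_radius; ring.
  pose es := cos s ^+ 2 + sin s ^+ 2; pose et := cos t ^+ 2 + sin t ^+ 2.
  transitivity ((r ^+ 2 * es - (a * cos s + b * sin s) ^+ 2) *
     (r ^+ 2 * et - (a * cos t + b * sin t) ^+ 2) -
     (r ^+ 2 * cos (s - t) - (a * cos s + b * sin s) * (a * cos t + b * sin t)) ^+ 2).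
    by rewrite /es /et !cos2Dsin2 !mulr1.
  rewrite /es /et cosB sinB.
  transitivity (r ^+ 2 * (r ^+ 2 - (a ^+ 2 + b ^+ 2)) *
     (sin s * cos t - cos s * sin t) ^+ 2); first by ring.
  by rewrite {2}r2; ring.
have X2 : X ^+ 2 <= (sin ds * sin dt) ^+ 2.
  by rewrite -subr_ge0 XE divr_ge0 ?sqr_ge0.
have p0 : 0 < sin ds * sin dt by rewrite mulr_gt0.
have Xge : - (sin ds * sin dt) <= X.
  by rewrite leNgt; apply/negP => XN; nra.
rewrite cosD -/ds -/dt ltrBlDr -ltrBlDl.
suff : - (sin ds * sin dt) < X by rewrite /X; lra.
(* Equality makes the three vectors coplanar, so [sin (s - t) = 0]. Coinciding boundary points
   contradict [0 < ds < pi]; antipodal ones give [ds + dt = pi]. *)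
rewrite lt_neqAle Xge andbT; apply/eqP => XN.
have sin0 : sin (s - t) = 0.
  apply/eqP; rewrite -sqrf_eq0; move/eqP : XE; rewrite -XN sqrrN subrr eq_sym.
  by rewrite mulf_eq0 invr_eq0 [r ^+ 2 == 0]sqrf_eq0 (gt_eqF r0) orbF.
have ct : cos t = cos s * cos (s - t).
  by rewrite -[in LHS](subKr s t) (cosB s (s - t)) sin0 mulr0 addr0.
have stE : sin t = sin s * cos (s - t).
  by rewrite -[in LHS](subKr s t) (sinB s (s - t)) sin0 mulr0 subr0.
have cc : cos dt = cos ds * cos (s - t).
  apply: (@mulfI _ r); first by rewrite gt_eqF.
  by rewrite cdt ct stE [RHS]mulrA cds; ring.
have : cos (s - t) ^+ 2 = 1 by have := cos2Dsin2 (s - t); rewrite sin0 expr0n/= addr0.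
move/eqP; rewrite sqrf_eq1 => /orP[/eqP c1|/eqP c1].
  move: XN; rewrite /X cc c1 mulr1 => XN.
  by have := cos2Dsin2 ds; have := sqr_ge0 (sin ds); nra.
have dtE : dt = pi - ds.
  apply: cos_inj; rewrite ?in_itv/=; [by rewrite !ltW| |].
    by apply/andP; split; lra.
  by rewrite cc c1 cosB cospi sinpi; ring.
lra.
Qed.

End Fiber.

(** * The invisible domain of the circle and monotonicity along the fibres *)

Section Generic.
Context {R : realType}.
Implicit Types (phi : R -> R) (a b t s x z w : R).

(* lift to the line of a generic achronal circle *)
Definition generic_lift phi := forall s t,
  `|phi s - phi t| <= acos (cos (s - t)) /\ `|phi s - phi t| < pi.

Lemma generic_lift_lip phi s t : generic_lift phi -> `|phi s - phi t| <= `|s - t|.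
Proof. by move=> /(_ s t)[H _]; apply: le_trans H (acos_cos_le _). Qed.

Lemma generic_liftN phi : generic_lift phi -> generic_lift (fun t => - phi t).
Proof. by move=> H s t; rewrite -opprD normrN; exact: H. Qed.

Lemma continuous_generic_lift phi : generic_lift phi -> continuous phi.
Proof.
move=> H t; apply/cvgrPdist_le => /= e e0; near=> s.
apply: (le_trans (generic_lift_lip _ _ H)); near: s.
exact: (@cvgr_dist_le _ _ _ _ _ id).
Unshelve. all: by end_near. Qed.

(** The point of the universal covering with coordinates [(a, b, x)] is spacelike related to the
    whole lifted circle. [Omega] is the counterpart in AdS, expressed by scalar products. *)
Definition invis phi a b x := forall t : R, 0 <= t <= 9 -> `|x - phi t| < bdist a b t.

Lemma num_cov phi a b x t : tnum phi t (cov a b x) = ads_radius a b * sin (x - phi t).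
Proof. by rewrite /tnum /cov !vec4E sinB; ring. Qed.

Lemma den_cov phi a b x t :
  tden phi t (cov a b x) = ads_radius a b * (cos (x - phi t) - cosdist a b t).
Proof.
rewrite /tden /cov !vec4E cosB /cosdist; have := radius_gt0 a b.
by move=> r0; field; rewrite gt_eqF.
Qed.

Lemma tau_cov phi a b x t :
  tau phi t (cov a b x) = sin (x - phi t) / (cos (x - phi t) - cosdist a b t).
Proof.
by rewrite /tau num_cov den_cov -mulf_div divff ?mul1r// gt_eqF// radius_gt0.
Qed.

Lemma cos_gt_cosdist a b t x : `|x| < bdist a b t -> cosdist a b t < cos x.
Proof.
have /andP[d0 dpi] := bdist_itv a b t.
move=> xd; rewrite -cos_bdist -(cos_norm x) ltr_cos// in_itv/= ?(ltW d0) ?(ltW dpi)//.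
by rewrite normr_ge0 ltW// (lt_trans xd).
Qed.

Lemma invis_Omega phi a b x : invis phi a b x -> Omega phi (cov a b x).
Proof.
move=> H t tl; rewrite den_cov mulr_gt0 ?radius_gt0// subr_gt0.
exact/cos_gt_cosdist/H.
Qed.

Lemma invis_convex phi a b x z w : invis phi a b x -> invis phi a b z ->
  x <= w <= z -> invis phi a b w.
Proof.
move=> Hx Hz /andP[xw wz] t tl; have := Hx t tl; have := Hz t tl.
by rewrite !ltr_norml => /andP[? ?] /andP[? ?]; apply/andP; split; lra.
Qed.

(** Membership in [Omega] constrains only cosines, hence the angle modulo [2 * pi]. A representative
    within [pi] of [phi 0] stays within [pi] of every [phi t]: at distance [pi] the cosine would be
    -1, which is below [cosdist]. *)
Lemma Omega_invis phi a b x : generic_lift phi -> Omega phi (cov a b x) ->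
  exists2 z, invis phi a b z & cov a b z = cov a b x.
Proof.
move=> gphi xO.
have [z [zpi zc zs]] := polar (cos2Dsin2 (x - phi 0)).
have zx : cov a b (z + phi 0) = cov a b x.
  rewrite /cov cosD sinD zc zs -cosD -sinD subrK//.
exists (z + phi 0) => //.
have cgt t : 0 <= t <= 9 -> cosdist a b t < cos (z + phi 0 - phi t).
  move=> tl; have := xO t tl; rewrite -zx den_cov pmulr_rgt0 ?radius_gt0//.
  by rewrite subr_gt0.
have npi t : 0 <= t <= 9 -> `|z + phi 0 - phi t| != pi.
  move=> tl; apply/eqP => H; have := cgt t tl.
  by rewrite -cos_norm H cospi ltNge; have /andP[/ltW->] := cosdist_itv a b t.
have ltpi t : 0 <= t <= 9 -> `|z + phi 0 - phi t| < pi.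
  move=> /andP[t0 t9]; rewrite ltNge; apply/negP => H.
  have [|//|c] := @IVT R (fun s => `|z + phi 0 - phi s|) 0 t pi t0.
    apply: continuous_subspaceT => s.
    apply: (@continuous_comp _ _ _ (fun s => z + phi 0 - phi s) Num.norm).
      by apply: cvgB; [exact: cvg_cst|exact: continuous_generic_lift].
    exact: norm_continuous.
  - by rewrite addrK ge_min le_max zpi H orbT.
  rewrite in_itv/= => /andP[c0 ct] /eqP; apply/negP; apply: npi.
  by rewrite c0 (le_trans ct).
move=> t tl; rewrite -ltr_cos ?in_itv/=.
- by rewrite cos_norm cos_bdist cgt.
- by rewrite normr_ge0 ltW// ltpi.
- by have /andP[/ltW-> /ltW->] := bdist_itv a b t.
Qed.

Lemma tau_increasing phi a b x z t : invis phi a b x -> invis phi a b z -> x < z ->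
  0 <= t <= 9 -> tau phi t (cov a b x) < tau phi t (cov a b z).
Proof.
move=> Hx Hz xz tl; rewrite !tau_cov.
have := Hx t tl; have := Hz t tl; rewrite !ltr_norml => /andP[z1 z2] /andP[x1 x2].
apply: (sin_ratio_increasing (bdist_itv a b t)) => //; first exact: cos_bdist.
by rewrite ltrD2r.
Qed.

Lemma cube_increasing (u v : R) : u < v -> u + u ^+ 3 < v + v ^+ 3.
Proof.
move=> uv; rewrite -subr_gt0.
have -> : v + v ^+ 3 - (u + u ^+ 3) =
  (v - u) * (1 + ((v + u / 2) ^+ 2 + 3 / 4 * u ^+ 2)) by field.
rewrite mulr_gt0 ?subr_gt0// ltr_wpDr// addr_ge0 ?sqr_ge0// mulr_ge0 ?sqr_ge0//.
Qed.

Lemma cont_tau_cube phi y : continuous phi -> Omega phi y ->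
  cont_on 9 (fun t => tau phi t y + tau phi t y ^+ 3).
Proof.
by move=> cphi yO; apply: cont_onD; [|apply: cont_onX]; exact: cont_tau.
Qed.

Lemma time_increasing phi a b x z : generic_lift phi ->
  invis phi a b x -> invis phi a b z -> x < z ->
  time phi (cov a b x) < time phi (cov a b z).
Proof.
move=> gphi Hx Hz xz; have cphi := continuous_generic_lift gphi.
rewrite !timeE//; try exact: invis_Omega.
apply: lt_itg => //.
- exact/cont_tau_cube/invis_Omega.
- exact/cont_tau_cube/invis_Omega.
by move=> t tl; apply: cube_increasing; exact: tau_increasing.
Qed.

(** The minimum is the upper end of the interval that [invis] cuts out of the fibre; applied to
    [- phi], the lemma gives the lower end. *)
Lemma invis_upper phi a b : continuous phi -> exists t, [/\ 0 <= t <= 9 &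
  forall s, 0 <= s <= 9 -> phi t + bdist a b t <= phi s + bdist a b s].
Proof.
move=> cphi; have [//| |t tl H] := @EVT_min R (fun t => phi t + bdist a b t) 0 9.
  apply: continuous_subspaceT => s; apply: cvgD; first exact: cphi.
  exact: continuous_bdist.
exists t; split; first by rewrite in_itv in tl.
by move=> s sl; apply: H; rewrite in_itv.
Qed.

Lemma invis_nonempty phi a b : generic_lift phi -> exists x, invis phi a b x.
Proof.
move=> gphi; have cphi := continuous_generic_lift gphi.
have [t [tl Ht]] := invis_upper a b cphi.
have [s [sl Hs]] := invis_upper a b (continuous_generic_lift (generic_liftN gphi)).
have lt_st : phi s - bdist a b s < phi t + bdist a b t.
  rewrite ltrBlDr -addrA -ltrBlDl.
  have [acs ltpi] := gphi s t.
  apply: (le_lt_trans (ler_norm _)).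
  (* If the two distances add up to at least [pi], genericity is enough; otherwise the strict
     triangle inequality applies. *)
  have [dpi|dpi] := leP pi (bdist a b t + bdist a b s); first exact: lt_le_trans dpi.
  by apply: (le_lt_trans acs); rewrite addrC; apply: bdist_triangle; rewrite addrC.
exists ((phi s - bdist a b s + (phi t + bdist a b t)) / 2) => u ul.
by have := Ht u ul; have := Hs u ul; rewrite ltr_norml => *; apply/andP; split; lra.
Qed.

End Generic.

Lemma cvg_vec4 {R : realType} T (F : set_system T) {FF : Filter F}
    (f0 f1 f2 f3 : T -> R) (l0 l1 l2 l3 : R) :
  f0 @ F --> l0 -> f1 @ F --> l1 -> f2 @ F --> l2 -> f3 @ F --> l3 ->
  (fun x => vec4 (f0 x) (f1 x) (f2 x) (f3 x)) @ F --> vec4 l0 l1 l2 l3.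
Proof.
move=> c0 c1 c2 c3.
have E a b c d : vec4 a b c d = a *: vec4 1 0 0 0 + b *: vec4 0 1 0 0 +
   c *: vec4 0 0 1 0 + d *: vec4 (0 : R) 0 0 1.
  by apply: rV4P; rewrite vec4E !mxE /=; ring.
rewrite E (_ : (fun x => _) = (fun x => f0 x *: vec4 1 0 0 0 + f1 x *: vec4 0 1 0 0 +
   f2 x *: vec4 0 0 1 0 + f3 x *: vec4 (0 : R) 0 0 1)); last first.
  by apply/funext => x; exact: E.
by apply: cvgD; [apply: cvgD; [apply: cvgD|]|]; exact: cvgZr_tmp.
Qed.

(** * A zero of the time function on every fibre *)

Section FiberPoint.
Context {R : realType}.
Implicit Types (phi : R -> R) (a b t s x z w : R).

Lemma cosdist_lipschitz a b s t : `|cosdist a b s - cosdist a b t| <= 2 * `|s - t|.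
Proof.
have r0 := radius_gt0 a b.
have ra (c : R) : c ^+ 2 <= a ^+ 2 + b ^+ 2 -> `|c / ads_radius a b| <= 1.
  move=> ca; have := @ltr_abs_sqr _ (c / ads_radius a b) 1 ler01.
  rewrite expr1n expr_div_n ltr_pdivrMr ?exprn_gt0// mul1r sqr_radius.
  by move=> /(_ ltac:(lra)) /andP[/ltW ? /ltW ?]; rewrite ler_norml; apply/andP.
have a1 : `|a / ads_radius a b| <= 1 by apply: ra; rewrite lerDl sqr_ge0.
have b1 : `|b / ads_radius a b| <= 1 by apply: ra; rewrite lerDr sqr_ge0.
have -> : cosdist a b s - cosdist a b t =
  (a / ads_radius a b) * (cos s - cos t) + (b / ads_radius a b) * (sin s - sin t).
  by rewrite /cosdist; ring.
apply: (le_trans (ler_normD _ _)); rewrite !(normrM (_ / _)) mulr2n mulrDl !mul1r.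
by apply: lerD; rewrite -[leRHS]mul1r; apply: ler_pM; rewrite -?normrM//;
  [exact: cos_lipschitz|exact: sin_lipschitz].
Qed.

(** The assumptions give [sin u >= sin d / 2] and [cos u - c <= 4 * e]. *)
Lemma sin_ratio_ge (d c0 c u e : R) : cos d = c0 -> 0 < e -> e <= sin d / 4 ->
  `|u - d| <= 2 * e -> `|c - c0| <= 2 * e -> 0 < cos u - c ->
  sin d / (8 * e) <= sin u / (cos u - c).
Proof.
move=> dc e0 esd ud cc0 cpos.
have := le_trans (sin_lipschitz _ _) ud; have := le_trans (cos_lipschitz _ _) ud.
move: cc0; rewrite dc !ler_norml => /andP[? ?] /andP[? ?] /andP[? ?].
rewrite ler_pdivlMr// mulrAC ler_pdivrMr; last by lra.
by nra.
Qed.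

(** The witness lies [e] below the upper end [M = phi t0 + d] of the fibre interval. For [t] within
    [e] of [t0], [tau] is at least [sin d / (8 * e)], so its cube contributes an amount of order
    [e ^- 2] over a window of length [e]. Elsewhere monotonicity bounds the integrand below by its
    values at [x]. *)
Lemma time_pos_somewhere phi a b x : generic_lift phi -> invis phi a b x ->
  exists z, [/\ x <= z, invis phi a b z & 0 < time phi (cov a b z)].
Proof.
move=> gphi Hx; have cphi := continuous_generic_lift gphi.
have [m m0 Hm] := cont_on_bounded (ler0n _ 9)
  (cont_tau_cube cphi (invis_Omega Hx)).
have [t0 [t0l Ht0]] := invis_upper a b cphi.
have /andP[d0 dpi] := bdist_itv a b t0; have cd := cos_bdist a b t0.
have := Hx t0 t0l; rewrite ltr_norml => /andP[_ xd].
move: (bdist a b t0) => d in Ht0 d0 dpi cd xd.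
have sd : 0 < sin d by rewrite sin_gt0_pi// d0.
have [M ME] : exists M, M = phi t0 + d by exists (phi t0 + d).
rewrite -ME in Ht0.
have xM : x < M by lra.
have k0 : 0 < 8 ^+ 3 * (9 * m + 1) by apply: mulr_gt0; [exact: exprn_gt0|lra].
(* The four bounds serve to fit a window of length [e] into [[0, 9]] and have [e ^+ 2 <= e], to
   apply [sin_ratio_ge], to stay above [x], and to make the peak outweigh the possible loss
   [9 * m]. *)
pose e := Num.min (Num.min 1 (sin d / 4)) (Num.min (M - x) (sin d ^+ 3 / (8 ^+ 3 * (9 * m + 1)))).
have e0 : 0 < e by rewrite !lt_min ltr01 subr_gt0 xM !divr_gt0 ?exprn_gt0.
have : e <= e by []. rewrite {2}/e !le_min => /andP[/andP[e1 esd] /andP[eM ek]].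
have {ek} ek : e * (8 ^+ 3 * (9 * m + 1)) <= sin d ^+ 3 by rewrite -ler_pdivlMr.
clearbody e.
have xz : x <= M - e by lra.
have Hz : invis phi a b (M - e).
  move=> t tl; have := Hx t tl; have := Ht0 t tl; rewrite !ltr_norml => *.
  by apply/andP; split; lra.
exists (M - e); split => //; rewrite timeE//; last exact: invis_Omega.
(* The window extends from [t0] to the side that remains inside [[0, 9]]. *)
have [s [s0 se st0]] : exists s, [/\ 0 <= s, s + e <= 9 &
    forall t, s <= t <= s + e -> `|t - t0| <= e].
  have [t08|t08] := leP t0 8.
    exists t0; split; [lra|lra|].
    by move=> t /andP[? ?]; rewrite ger0_norm; lra.
  exists (t0 - e); split; [lra|lra|].
  by move=> t /andP[? ?]; rewrite ler_norml; apply/andP; split; lra.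
pose T := sin d ^+ 3 / (8 ^+ 3 * e ^+ 3).
apply: (@lt_le_trans _ _ (T * e - m * 9)).
  have -> : T * e = sin d ^+ 3 / 8 ^+ 3 / e ^+ 2 by rewrite /T; field; rewrite gt_eqF.
  have : 9 * m + 1 <= sin d ^+ 3 / 8 ^+ 3 / e ^+ 2.
    rewrite ler_pdivlMr ?exprn_gt0// ler_pdivlMr ?exprn_gt0//.
    have -> : (9 * m + 1) * e ^+ 2 * 8 ^+ 3 = e ^+ 2 * (8 ^+ 3 * (9 * m + 1)) by ring.
    apply: le_trans ek.
    apply: ler_wpM2r; first exact: ltW.
    by rewrite expr2 ler_piMr// ltW.
  by lra.
apply: (itg_ge_bump (s := s)) => //; [exact: ltW|exact: ltW| | |].
- exact/cont_tau_cube/invis_Omega.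
- move=> t tl; have := Hm t tl; rewrite ler_norml => /andP[Hmt _].
  apply: (le_trans Hmt); have := xz; rewrite le_eqVlt => /predU1P[->//|xz'].
  by apply/ltW/cube_increasing; exact: tau_increasing.
move=> t ts; have tt0 := st0 t ts.
have tl : 0 <= t <= 9 by case/andP: ts => *; apply/andP; split; lra.
have tau_ge : sin d / (8 * e) <= tau phi t (cov a b (M - e)).
  rewrite tau_cov; apply: (sin_ratio_ge cd) => //.
  - have -> : M - e - phi t - d = (phi t0 - phi t) - e by rewrite ME; ring.
    apply: (le_trans (ler_normB _ _)); rewrite (gtr0_norm e0) mulr2n mulrDl mul1r lerD2r.
    by apply: le_trans tt0; rewrite (distrC t) generic_lift_lip.
  - by apply: (le_trans (cosdist_lipschitz a b t t0)); rewrite ler_wpM2l.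
  - by rewrite subr_gt0; exact/cos_gt_cosdist/Hz.
have T0 : 0 < sin d / (8 * e) by rewrite divr_gt0// mulr_gt0.
have -> : T = (sin d / (8 * e)) ^+ 3 by rewrite /T; field; rewrite gt_eqF.
apply: ler_wpDl; first by rewrite (le_trans _ tau_ge)// ltW.
by rewrite lerXn2r// ?nnegrE; [exact: ltW|exact: le_trans (ltW T0) tau_ge].
Qed.

Lemma invisN phi a b x : invis phi a b x -> invis (fun t => - phi t) a b (- x).
Proof. by move=> H t tl; rewrite -opprD normrN; exact: H. Qed.

Lemma invisNK phi a b x : invis (fun t => - phi t) a b x -> invis phi a b (- x).
Proof. by move=> H t tl; rewrite -opprB opprK addrC normrN -[phi t]opprK; exact: H. Qed.

Lemma tauN phi a b x t :
  tau (fun t => - phi t) t (cov a b (- x)) = - tau phi t (cov a b x).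
Proof. by rewrite !tau_cov -opprB opprK [- phi t + x]addrC sinN cosN mulNr. Qed.

(** Time reversal, which negates both [x] and [phi], makes [tau] and its cube change sign. It turns
    positive values of [time] near the upper end of a fibre into negative ones near the lower
    end. *)
Lemma timeN phi a b x : generic_lift phi -> invis phi a b x ->
  time (fun t => - phi t) (cov a b (- x)) = - time phi (cov a b x).
Proof.
move=> gphi Hx; have cphi := continuous_generic_lift gphi.
have cN := continuous_generic_lift (generic_liftN gphi).
rewrite !timeE//; [|exact: invis_Omega|exact/invis_Omega/invisN].
rewrite -[RHS]mulN1r -itgZ; last first.
  by apply: cont_tau_cube => //; exact: invis_Omega.
by congr itg; apply/funext => t; rewrite tauN; ring.
Qed.

Lemma time_neg_somewhere phi a b x : generic_lift phi -> invis phi a b x ->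
  exists z, [/\ z <= x, invis phi a b z & time phi (cov a b z) < 0].
Proof.
move=> gphi Hx.
have [z [xz Hz tz]] := time_pos_somewhere (generic_liftN gphi) (invisN Hx).
exists (- z); split; [by rewrite lerNl|exact: invisNK|].
by rewrite -oppr_gt0 -timeN ?opprK//; exact: invisNK.
Qed.

Lemma continuous_cov a b : continuous (cov a b).
Proof.
move=> x; apply: cvg_vec4; try exact: cvg_cst.
  by apply: cvgM; [exact: cvg_cst|exact: continuous_cos].
by apply: cvgM; [exact: cvg_cst|exact: continuous_sin].
Qed.

Lemma continuous_time phi y : continuous phi -> Omega phi y ->
  {for y, continuous (time phi)}.
Proof.
by move=> cphi yO; have dt := is_diff_time cphi yO; exact: differentiable_continuous.
Qed.

Lemma time_IVT phi a b x z : generic_lift phi -> invis phi a b x -> invis phi a b z ->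
  x <= z -> time phi (cov a b x) <= 0 <= time phi (cov a b z) ->
  exists w, [/\ x <= w <= z, invis phi a b w & time phi (cov a b w) = 0].
Proof.
move=> gphi Hx Hz xz /andP[tx tz].
have [||w] := @IVT R (time phi \o cov a b) x z 0 xz.
- apply: continuous_in_subspaceT => w; rewrite inE/= in_itv/= => wl.
  apply: continuous_comp; first exact: continuous_cov.
  apply: continuous_time; first exact: continuous_generic_lift.
  by apply: invis_Omega; exact: invis_convex wl.
- by rewrite ge_min le_max /= tx tz orbT.
rewrite in_itv/= => wl w0; exists w; split => //.
exact: invis_convex wl.
Qed.

Lemma fiber_point phi a b : generic_lift phi ->
  exists x, invis phi a b x /\ time phi (cov a b x) = 0.
Proof.
move=> gphi; have [x0 H0] := invis_nonempty a b gphi.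
have [z [xz Hz tz]] := time_pos_somewhere gphi H0.
have [x [xx Hx tx]] := time_neg_somewhere gphi H0.
have [||w [_ Hw tw]] := time_IVT gphi Hx Hz; last by exists w.
  exact: le_trans xx xz.
by rewrite !ltW.
Qed.

End FiberPoint.

(** * The zero set of the time function *)

Lemma continuous_pair {T U V : topologicalType} (f : T -> U) (g : T -> V) x :
  {for x, continuous f} -> {for x, continuous g} ->
  {for x, continuous (fun z => (f z, g z))}.
Proof. by move=> cf cg; exact: (cvg_pair cf cg). Qed.

Section Surface.
Context {R : realType}.
Implicit Types (phi : R -> R) (a b t s x z : R) (y w : 'rV[R]_4).

Definition surf phi : set 'rV[R]_4 :=
  [set y | [/\ Q y = -1, Omega phi y & time phi y = 0]].

(** The angles may differ by a multiple of [2 * pi], so only the points of AdS are claimed equal.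
    [Omega_invis] supplies representatives among which [time] is strictly increasing. *)
Lemma surf_unique phi a b x z : generic_lift phi ->
  surf phi (cov a b x) -> surf phi (cov a b z) -> cov a b x = cov a b z.
Proof.
move=> gphi [_ Ox tx] [_ Oz tz].
have [x' Hx' xE] := Omega_invis gphi Ox; have [z' Hz' zE] := Omega_invis gphi Oz.
rewrite -xE -zE; rewrite -xE in tx; rewrite -zE in tz.
have [xz|zx|-> //] := ltgtP x' z'.
- by have := time_increasing gphi Hx' Hz' xz; rewrite tx tz ltxx.
- by have := time_increasing gphi Hz' Hx' zx; rewrite tx tz ltxx.
Qed.

(** In contrast with [Omega_invis] the angle itself is kept; this allows one fixed angle to be
    followed while the base point moves. *)
Lemma Omega_invis_pi phi a b x : Omega phi (cov a b x) ->
  (forall t, 0 <= t <= 9 -> `|x - phi t| < pi) -> invis phi a b x.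
Proof.
move=> xO xpi t tl; rewrite -ltr_cos ?in_itv/=.
- rewrite cos_norm cos_bdist; have := xO t tl.
  by rewrite den_cov pmulr_rgt0 ?radius_gt0// subr_gt0.
- by rewrite normr_ge0 ltW// xpi.
- by have /andP[/ltW-> /ltW->] := bdist_itv a b t.
Qed.

Lemma invis_open phi a b x : continuous phi -> invis phi a b x ->
  exists2 k, 0 < k & forall z, `|z - x| <= k -> invis phi a b z.
Proof.
move=> cphi Hx.
have [||k k0 Hk] := @cont_on_pos R 9 (fun t => bdist a b t - `|x - phi t|) (ler0n _ 9).
- apply: cont_onT => t; apply: cvgB; first exact: continuous_bdist.
  apply: (@continuous_comp _ _ _ (fun s => x - phi s) Num.norm).
    by apply: cvgB; [exact: cvg_cst|exact: cphi].
  exact: norm_continuous.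
- by move=> t /Hx; rewrite subr_gt0.
exists (k / 2); first by rewrite divr_gt0.
move=> z zx t tl; have := Hk t tl.
have -> : z - phi t = (z - x) + (x - phi t) by ring.
by have := ler_normD (z - x) (x - phi t); lra.
Qed.

Lemma continuous_cov_base x : continuous (fun p : R * R => cov p.1 p.2 x).
Proof.
move=> p; have c1 : (fun q : R * R => q.1) @ p --> p.1 by exact: cvg_fst.
have c2 : (fun q : R * R => q.2) @ p --> p.2 by exact: cvg_snd.
have cr : (fun q : R * R => ads_radius q.1 q.2) @ p --> ads_radius p.1 p.2.
  apply: (@continuous_comp _ _ _ (fun q : R * R => 1 + q.1 ^+ 2 + q.2 ^+ 2) Num.sqrt);
    last exact: sqrt_continuous.
  by apply: cvgD; [apply: cvgD; [exact: cvg_cst|apply: cvgM]|apply: cvgM].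
by apply: cvg_vec4 => //; apply: cvgM => //; exact: cvg_cst.
Qed.

Variable phi : R -> R.
Hypothesis gphi : generic_lift phi.

Definition height (p : R * R) : R := projT1 (cid (fiber_point p.1 p.2 gphi)).

Lemma invis_height p : invis phi p.1 p.2 (height p).
Proof. by rewrite /height; case: cid => x []. Qed.

Lemma time_height p : time phi (cov p.1 p.2 (height p)) = 0.
Proof. by rewrite /height; case: cid => x []. Qed.

Lemma height_unique p x : invis phi p.1 p.2 x -> time phi (cov p.1 p.2 x) = 0 ->
  x = height p.
Proof.
move=> Hx tx; have Hh := invis_height p; have th := time_height p.
have [xz|zx|//] := ltgtP x (height p).
- by have := time_increasing gphi Hx Hh xz; rewrite tx th ltxx.
- by have := time_increasing gphi Hh Hx zx; rewrite tx th ltxx.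
Qed.

(** Over [p] the time function is negative at [x - d] and positive at [x + d]. At these two fixed
    angles the signs, and membership in [Omega], persist over nearby base points, which traps their
    unique zero in between. *)
Lemma continuous_height : continuous height.
Proof.
have cphi := continuous_generic_lift gphi.
move=> p; apply/cvgrPdist_le => /= e e0.
set x := height p; have Hx := invis_height p; have tx := time_height p.
have [k k0 Hk] := invis_open cphi Hx.
have [d [d0 de dk]] : exists d, [/\ 0 < d, d <= e & d <= k].
  by exists (Num.min e k); rewrite lt_min e0 k0 !ge_min !lexx orbT.
have Hp : invis phi p.1 p.2 (x + d) by apply: Hk; rewrite addrAC subrr add0r gtr0_norm.
have Hm : invis phi p.1 p.2 (x - d).
  by apply: Hk; rewrite addrAC subrr add0r normrN gtr0_norm.
have tp : 0 < time phi (cov p.1 p.2 (x + d)).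
  by rewrite -tx; apply: time_increasing => //; rewrite ltrDl.
have tm : time phi (cov p.1 p.2 (x - d)) < 0.
  by rewrite -tx; apply: time_increasing => //; rewrite ltrBlDr ltrDl.
have nearO z : invis phi p.1 p.2 z -> \forall q \near p, Omega phi (cov q.1 q.2 z).
  move=> Hz; have OH : nbhs (cov p.1 p.2 z) (Omega phi).
    by apply: open_nbhs_nbhs; split; [exact: open_Omega|exact: invis_Omega].
  exact: (@continuous_cov_base z p _ OH).
have ct z : invis phi p.1 p.2 z ->
    (fun q : R * R => time phi (cov q.1 q.2 z)) @ p --> time phi (cov p.1 p.2 z).
  move=> Hz; apply: (@continuous_comp _ _ _ (fun q : R * R => cov q.1 q.2 z) (time phi)).
    exact: continuous_cov_base.
  by apply: continuous_time => //; exact: invis_Omega.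
(* Over [p], [invis] puts [z] within [pi] of every [phi t], a bound independent of the base
   point. *)
have bdpi q z : invis phi p.1 p.2 z -> Omega phi (cov q.1 q.2 z) ->
    invis phi q.1 q.2 z.
  move=> Hz zO; apply: Omega_invis_pi => // t tl; apply: lt_trans (Hz t tl) _.
  by have /andP[] := bdist_itv p.1 p.2 t.
near=> q.
have Op : Omega phi (cov q.1 q.2 (x + d)) by near: q; exact: nearO.
have Om : Omega phi (cov q.1 q.2 (x - d)) by near: q; exact: nearO.
have tqp : 0 < time phi (cov q.1 q.2 (x + d)).
  by near: q; apply: (cvgr_gt _ (ct _ Hp)).
have tqm : time phi (cov q.1 q.2 (x - d)) < 0.
  by near: q; apply: (cvgr_lt _ (ct _ Hm)).
have [||w [/andP[w1 w2] Hw tw]] := time_IVT gphi (bdpi _ _ Hm Om) (bdpi _ _ Hp Op).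
- by rewrite lerBlDr -addrA lerDl addr_ge0 ?ltW.
- by rewrite !ltW.
rewrite -(height_unique Hw tw) -/x distrC; apply: le_trans de.
by rewrite ler_distl w1 w2.
Unshelve. all: by end_near. Qed.

Definition section (p : R * R) : 'rV[R]_4 := cov p.1 p.2 (height p).

Lemma continuous_section : continuous section.
Proof.
move=> p; have c1 : (fun q : R * R => q.1) @ p --> p.1 by exact: cvg_fst.
have c2 : (fun q : R * R => q.2) @ p --> p.2 by exact: cvg_snd.
have cr : (fun q : R * R => ads_radius q.1 q.2) @ p --> ads_radius p.1 p.2.
  apply: (@continuous_comp _ _ _ (fun q : R * R => 1 + q.1 ^+ 2 + q.2 ^+ 2) Num.sqrt);
    last exact: sqrt_continuous.
  by apply: cvgD; [apply: cvgD; [exact: cvg_cst|apply: cvgM]|apply: cvgM].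
apply: cvg_vec4 => //; apply: cvgM => //.
  by apply: (@continuous_comp _ _ _ height cos);
    [exact: continuous_height|exact: continuous_cos].
by apply: (@continuous_comp _ _ _ height sin);
    [exact: continuous_height|exact: continuous_sin].
Qed.

Lemma surf_section p : surf phi (section p).
Proof.
split; [exact: Q_cov|exact/invis_Omega/invis_height|exact: time_height].
Qed.

Lemma surfE y : surf phi y <-> y = section (y 0 2, y 0 3).
Proof.
split=> [Sy|->]; last exact: surf_section.
have [x yE] : exists x, y = cov (y 0 2) (y 0 3) x by apply: AdS_cov; case: Sy.
have Sx : surf phi (cov (y 0 2) (y 0 3) x) by rewrite -yE.
by rewrite [LHS]yE; exact: (surf_unique gphi Sx (surf_section (y 0 2, y 0 3))).
Qed.

(** The definition only shows closedness inside the open set [Omega]; being a continuous graph over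
    the whole plane of the last two coordinates makes the surface closed in the ambient space. *)
Lemma closed_surf : closed (surf phi).
Proof.
pose g y := y - section (y 0 2, y 0 3).
have cg : continuous g.
  move=> y; apply: (@continuousB _ _ _ id (fun y => section (y 0 2, y 0 3))).
    by move=> A.
  apply: (@continuous_comp _ _ _ (fun y : 'rV[R]_4 => (y 0 2, y 0 3)) section);
    last exact: continuous_section.
  by apply: continuous_pair; exact: coord_continuous.
have -> : surf phi = (fun y => `|g y|) @^-1` [set x | x = 0].
  apply/seteqP; split=> y /=; rewrite /g.
    by move/surfE => yE; apply/eqP; rewrite normr_eq0 subr_eq0; apply/eqP.
  by move/eqP; rewrite normr_eq0 subr_eq0 => /eqP/surfE.
apply: preimage_closed => [y _|]; last exact: closed_eq.
by apply: (@continuous_comp _ _ _ g Num.norm); [exact: cg|exact: norm_continuous].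
Qed.

(** Segments from the origin of the [(a, b)] plane lift through [section] to paths with a common
    end. *)
Lemma connected_surf : connected (surf phi).
Proof.
pose ray (p : R * R) (s : R) := section (s * p.1, s * p.2).
have -> : surf phi = \bigcup_(p in [set: R * R]) (ray p @` `[0, 1]).
  apply/seteqP; split=> [y /surfE ->|y [p _ [s _ <-]]]; last exact: surf_section.
  exists (y 0 2, y 0 3) => //; exists 1; first by rewrite /= in_itv/= ler01 lexx.
  by rewrite /ray/= !mul1r.
apply: bigcup_connected.
  exists (section (0, 0)) => p _; exists 0; first by rewrite /= in_itv/= ler01 lexx.
  by rewrite /ray !mul0r.
move=> p _; apply: connected_continuous_connected; first exact: segment_connected.
apply: continuous_subspaceT => s.
apply: (@continuous_comp _ _ _ (fun s : R => (s * p.1, s * p.2)) section);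
    last exact: continuous_section.
by apply: continuous_pair; exact: mulrr_continuous.
Qed.

End Surface.

(** * Submanifold structure and spacelike tangent vectors *)

Section Spacelike.
Context {R : realType}.
Variable phi : R -> R.
Hypothesis cphi : continuous phi.
Implicit Types y w p v : 'rV[R]_4.

Lemma lorentz_linear y : linear (lorentz y).
Proof. by move=> k u v; rewrite /lorentz !mxE /GRing.scale/=; ring. Qed.

Lemma normM_le (a b m n : R) : `|a| <= m -> `|b| <= n -> `|a * b| <= m * n.
Proof. by move=> am bn; rewrite normrM; apply: ler_pM. Qed.

Lemma lorentz_le y w : `|lorentz y w| <= 4 * (`|y| * `|w|).
Proof.
have H i := normM_le (coord_le_norm y 0 i) (coord_le_norm w 0 i).
have := H 0; have := H 1; have := H 2; have := H 3.
by rewrite /lorentz !mulNr !ler_norml; lra.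
Qed.

Lemma is_diff_Q y : is_diff y (fun z => Q z + 1 : R) (fun w => 2 * lorentz y w).
Proof.
have Q0 : 0 <= 8 * `|y| by rewrite mulr_ge0.
apply: (@is_diff_quadratic _ _ _ _ _ _ (8 * `|y| + 4) 1) => //.
- by move=> k u v; rewrite lorentz_linear /GRing.scale/=; ring.
- move=> w; rewrite normrM ger0_norm//; have := lorentz_le y w.
  by have := normr_ge0 w; nra.
move=> h _; have -> : Q (y + h) + 1 - (Q y + 1) - 2 * lorentz y h = lorentz h h.
  by rewrite /Q /lorentz !mxE; ring.
apply: (le_trans (lorentz_le h h)); rewrite -expr2 ler_wpM2r ?sqr_ge0//.
by rewrite lerDr.
Qed.

Lemma class_C_Q k (U : set 'rV[R]_4) : class_C U k (fun y => Q y + 1 : R).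
Proof.
case: k => [|k] /=.
  by move=> y _; have dQ := is_diff_Q y; exact: differentiable_continuous.
split=> [y _|v]; first by have dQ := is_diff_Q y.
rewrite (_ : (fun y => _) = (fun y => 2 * lorentz v y)); last first.
  apply/funext => y; have dQ := is_diff_Q y; rewrite deriveE// diff_val.
  by rewrite /lorentz; ring.
apply: class_C_linear => y.
apply: (@is_diff_quadratic _ _ _ _ _ _ (8 * `|v|) 1) => //.
- by move=> l u w; rewrite lorentz_linear /GRing.scale/=; ring.
- by move=> w; rewrite normrM ger0_norm//; have := lorentz_le v w; lra.
move=> h _; rewrite (_ : _ - _ = 0) ?normr0 ?mulr_ge0 ?sqr_ge0//.
by rewrite /lorentz !mxE; ring.
Qed.

Lemma Q_lorentz y : Q y = lorentz y y.
Proof. by rewrite /Q /lorentz; ring. Qed.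

Lemma submanifold_surf : submanifold 2 (surf phi).
Proof.
move=> p [Qp pO tp].
exists (Omega phi), (fun (i : 'I_2) y => if i == 0 then Q y + 1 else time phi y).
split.
- by split; first exact: open_Omega.
- move=> i k; case: (i == 0); last exact: class_C_time.
  exact: class_C_Q.
- apply/seteqP; split=> y.
    by move=> [[Qy yO ty] _]; split=> // i; case: (i == 0); rewrite ?Qy ?ty ?addNr.
  move=> [yO H]; split=> //; split=> //; last by have := H 1.
  by have := H 0; rewrite eqxx; lra.
move=> y [Qy yO ty] _ c Hc.
have dQ := is_diff_Q y; have dt := is_diff_time cphi yO.
have Hc' v : c 0 * (2 * lorentz y v) + c 1 * 'd (time phi) y v = 0.
  have := Hc v; rewrite big_ord_recl big_ord1.
  have -> : lift ord0 ord0 = 1 :> 'I_2 by exact: val_inj.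
  by rewrite /= diff_val.
(* The rotation field of the [(u, v)] plane is tangent to AdS and future timelike: the differential
   of [Q] vanishes on it, that of [time] does not. The other coefficient is then tested on [y]
   itself, where [lorentz y y = -1]. *)
pose w := vec4 (- y 0 1) (y 0 0) 0 0.
have yw : lorentz y w = 0 by rewrite /lorentz /w !vec4E; ring.
have wpos : 0 < y 0 0 * w 0 1 - y 0 1 * w 0 0.
  rewrite /w !vec4E; move: Qy; rewrite /Q.
  have := sqr_ge0 (y 0 2); have := sqr_ge0 (y 0 3); rewrite !expr2; lra.
have Qw : Q w <= 0.
  rewrite /Q /w !vec4E; have := sqr_ge0 (y 0 0); have := sqr_ge0 (y 0 1).
  by rewrite !expr2; lra.
have dtw := time_future cphi yO Qy yw Qw wpos.
have c1 : c 1 = 0.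
  have /eqP := Hc' w; rewrite yw !mulr0 add0r mulf_eq0 (gt_eqF dtw) orbF.
  by move/eqP.
have c0 : c 0 = 0.
  by have := Hc' y; rewrite c1 mul0r addr0 -Q_lorentz Qy; lra.
move=> i; case: i => -[|[|//]] i2.
- by rewrite (_ : Ordinal i2 = 0)//; exact: val_inj.
- by rewrite (_ : Ordinal i2 = 1)//; exact: val_inj.
Qed.

(** The composite of [g] with the curve defining [v] is constant near 0, and the chain rule
    applies. *)
Lemma tangent_ker (S : set 'rV[R]_4) p v (g dg : 'rV[R]_4 -> R) c :
  tangent S p v -> (forall y, S y -> g y = c) -> is_diff p g dg -> dg v = 0.
Proof.
move=> [gam [e [e0 sg Sg g0 gv]]] gc dp.
have [dgam _] := sg 1%N.
have I0 : 0 \in `]- e, e[ by rewrite in_itv/= oppr_lt0 e0.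
have dgam0 := dgam 0 I0.
have dg0 : differentiable g (gam 0) by rewrite g0; exact: ex_diff.
have : 'D_1 (g \o gam) 0 = 0.
  transitivity ('D_1 (cst c : R -> R) 0); last exact: derive_cst.
  apply: near_eq_derive.
  near=> t; rewrite /= gc//; apply: Sg; near: t.
  exact: near_in_itvoo I0.
rewrite deriveE; last exact: differentiable_comp.
rewrite diff_comp//= (_ : 'd gam 0 1 = v); last by rewrite -gv deriveE.
by rewrite g0 diff_val.
Unshelve. all: by end_near. Qed.

(** The differentials of [Q] and [time] vanish on a tangent vector. Were it causal with a nonzero
    angular component, it or its opposite would be future directed, and [time] would strictly
    increase along it. *)
Lemma spacelike_surf : spacelike (surf phi).
Proof.
move=> p v [Qp pO tp] tan v0; rewrite ltNge; apply/negP => Qv.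
have dQ := is_diff_Q p; have dt := is_diff_time cphi pO.
have lpv : lorentz p v = 0.
  have Q0 y : surf phi y -> Q y + 1 = 0 by move=> [-> _ _]; rewrite addNr.
  by have := tangent_ker tan Q0 dQ; lra.
have tv : 'd (time phi) p v = 0.
  have t0 y : surf phi y -> time phi y = 0 by case.
  by rewrite diff_val; exact: (tangent_ker tan t0 dt).
have [al|al|al] := ltgtP 0 (p 0 0 * v 0 1 - p 0 1 * v 0 0).
- by have := time_future cphi pO Qp lpv Qv al; rewrite tv ltxx.
- have Nlor : lorentz p (- v) = 0 by move: lpv; rewrite /lorentz !mxE; lra.
  have NQ : Q (- v) <= 0 by move: Qv; rewrite /Q !mxE !sqrrN.
  have Nal : 0 < p 0 0 * (- v) 0 1 - p 0 1 * (- v) 0 0 by rewrite !mxE; lra.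
  by have := time_future cphi pO Qp Nlor NQ Nal; rewrite linearN tv oppr0 ltxx.
(* v has no angular component, so v_0 and v_1 are determined by (v_2, v_3); as
   p_0^2 + p_1^2 > p_2^2 + p_3^2, causality of v forces v = 0 *)
move/eqP: v0; apply.
move: Qp lpv Qv al; rewrite /Q /lorentz.
move: (p 0 0) (p 0 1) (p 0 2) (p 0 3) => p0 p1 p2 p3 Qp lpv Qv al.
have key : (p0 ^+ 2 + p1 ^+ 2) * (v 0 0 ^+ 2 + v 0 1 ^+ 2) =
    (p2 * v 0 2 + p3 * v 0 3) ^+ 2.
  have -> : (p0 ^+ 2 + p1 ^+ 2) * (v 0 0 ^+ 2 + v 0 1 ^+ 2) =
    (p0 * v 0 0 + p1 * v 0 1) ^+ 2 + (p0 * v 0 1 - p1 * v 0 0) ^+ 2 by ring.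
  by rewrite -al expr0n /= addr0; congr (_ ^+ 2); lra.
have CS : (p2 * v 0 2 + p3 * v 0 3) ^+ 2 <=
   (p2 ^+ 2 + p3 ^+ 2) * (v 0 2 ^+ 2 + v 0 3 ^+ 2).
  rewrite -subr_ge0; have -> : (p2 ^+ 2 + p3 ^+ 2) * (v 0 2 ^+ 2 + v 0 3 ^+ 2) -
    (p2 * v 0 2 + p3 * v 0 3) ^+ 2 = (p2 * v 0 3 - p3 * v 0 2) ^+ 2 by ring.
  exact: sqr_ge0.
have pE : p0 ^+ 2 + p1 ^+ 2 = 1 + (p2 ^+ 2 + p3 ^+ 2) by lra.
have Vle : v 0 2 ^+ 2 + v 0 3 ^+ 2 <= v 0 0 ^+ 2 + v 0 1 ^+ 2 by lra.
have P0 : 0 <= p2 ^+ 2 + p3 ^+ 2 by rewrite addr_ge0 ?sqr_ge0.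
have U0 : v 0 0 ^+ 2 + v 0 1 ^+ 2 = 0.
  apply/eqP; rewrite eq_le addr_ge0 ?sqr_ge0// andbT.
  by have := ler_wpM2l P0 Vle; move: key; rewrite pE mulrDl mul1r; lra.
have s0 := sqr_ge0 (v 0 0); have s1 := sqr_ge0 (v 0 1).
have s2 := sqr_ge0 (v 0 2); have s3 := sqr_ge0 (v 0 3).
by apply: rV4P; rewrite mxE; apply/eqP; rewrite -sqrf_eq0; apply/eqP; lra.
Qed.

End Spacelike.

(** * Ideal boundary *)

Section Rays.
Context {R : realType}.
Local Open Scope quotient_scope.
Implicit Types (y z : @nonzero R) (A B : set 'rV[R]_4).

Lemma pi_raysP y z : \pi_(rays R) y = \pi_(rays R) z <->
  exists2 t : R, 0 < t & val z = t *: val y.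
Proof.
have E := @eqmodP _ (same_ray_equiv_rel R) y z.
split; first by move=> /E /asboolP.
by move=> H; apply/E/asboolP.
Qed.

Lemma nonzeroP (x : 'rV[R]_4) : x != 0 -> exists z : @nonzero R, val z = x.
Proof. by move=> x0; exists (@exist _ _ x (mem_set x0)). Qed.

Lemma nonzero_neq0 z : val z != 0.
Proof. by have := valP z; rewrite inE. Qed.

(** Closure in the quotient topology becomes approximation up to positive scaling. In one direction,
    the rays meeting a ball around [z] form an open set, since their preimage is a union of open
    sets indexed by the scaling factor; in the other, the projection is continuous. *)
Lemma closure_raysP A z : closure (rays_of A) (\pi_(rays R) z) <->
  forall e : R, 0 < e -> exists x (t : R), [/\ A x, x != 0, 0 < t &
    `|val z - t *: x| < e].
Proof.
split=> [cA e e0|H N].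
  pose O := [set r | exists y, [/\ \pi_(rays R) y = r &
     exists2 t : R, 0 < t & `|val z - t *: val y| < e]].
  have oO : open O.
    rewrite /open/= /quotient_open/=.
    have -> : (\pi_(rays R) @^-1` O) =
      \bigcup_(t in [set t : R | 0 < t]) ((fun y => `|val z - t *: val y|) @^-1` [set x | x < e]).
      apply/seteqP; split=> y /=.
        move=> [w [/pi_raysP[s s0 yw] [t t0 wt]]].
        exists (t / s); first by rewrite /= divr_gt0.
        by rewrite /= yw scalerA divfK// gt_eqF.
      by move=> [t t0 yt]; exists y; split=> //; exists t.
    apply: bigcup_open => t _; apply: open_comp; last exact: open_lt.
    move=> y _.
    apply: (@continuous_comp _ _ _ set_val (fun x : 'rV[R]_4 => `|val z - t *: x|)).
      exact: initial_continuous.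
    apply: (@continuous_comp _ _ _ (fun x : 'rV[R]_4 => val z - t *: x) Num.norm);
      last exact: norm_continuous.
    apply: (@continuousB _ _ _ (cst (val z)) (fun x : 'rV[R]_4 => t *: x)).
      exact: cst_continuous.
    exact: scaler_continuous.
  have [|r [[x Ax <-] [y [yx [t t0 yt]]]]] := cA O.
    apply: open_nbhs_nbhs; split=> //; exists z; split=> //.
    by exists 1; rewrite ?scale1r ?subrr ?normr0.
  have [s s0 xy] := (pi_raysP _ _).1 (esym yx).
  exists (val x), (t * s); split=> //; first exact: nonzero_neq0.
    exact: mulr_gt0.
  by rewrite -scalerA -xy.
move=> /pi_continuous /nbhs_ballP[e e0 zN].
have [x [t [Ax x0 t0 zx]]] := H e e0.
have [y yx] := nonzeroP x0.
have tx0 : t *: x != 0 by rewrite scaler_eq0 (gt_eqF t0).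
have [w wx] := nonzeroP tx0.
exists (\pi_(rays R) y); split; first by exists y; rewrite //= yx.
have -> : \pi_(rays R) y = \pi_(rays R) w.
  by apply/pi_raysP; exists t; rewrite // wx yx.
by apply: zN; rewrite -initial_ballE /= -ball_normE /= [set_val w]wx.
Qed.

End Rays.

Section IdealBoundary.
Context {R : realType}.
Local Open Scope quotient_scope.
Implicit Types (y z : 'rV[R]_4) (t : R).

(** As [pi / 2 < 2], a full turn is shorter than 9; a negative angle given by [polar] is shifted by
    one turn. *)
Lemma circle_param (u v : R) : u ^+ 2 + v ^+ 2 = 1 ->
  exists t, [/\ 0 <= t <= 9, cos t = u & sin t = v].
Proof.
have := @pihalf_lt2 R; have := @pi_ge0 R => p0 p2.
move=> /polar[x [xp cx sx]]; move: xp; rewrite ler_norml => /andP[x1 x2].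
have [x0|x0] := leP 0 x; first by exists x; split=> //; apply/andP; split; lra.
exists (x + pi *+ 2); split; [|by rewrite cosD2pi|by rewrite sinD2pi].
by rewrite mulr2n; apply/andP; split; lra.
Qed.

Variable phi : R -> R.
Hypothesis gphi : generic_lift phi.

Definition ideal_point t : 'rV[R]_4 := vec4 (cos (phi t)) (sin (phi t)) (cos t) (sin t).

Lemma Q_ideal_point t : Q (ideal_point t) = 0.
Proof.
rewrite /Q /ideal_point !vec4E.
transitivity (- (cos (phi t) ^+ 2 + sin (phi t) ^+ 2) + (cos t ^+ 2 + sin t ^+ 2)).
  by ring.
by rewrite !cos2Dsin2 addNr.
Qed.

(** For the [t] that gives the direction of [(z_2, z_3)], the hypothesis says that the scalar
    product of [(z_0, z_1)] with the unit vector at angle [phi t] is at least [r]. As [z] is null,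
    [r] is also the norm of [(z_0, z_1)], so this is the equality case of Cauchy-Schwarz. *)
Lemma tden_ideal_point z : Q z = 0 -> z != 0 ->
  (forall t, 0 <= t <= 9 -> 0 <= tden phi t z) ->
  exists t (r : R), [/\ 0 <= t <= 9, 0 < r & z = r *: ideal_point t].
Proof.
move=> Qz z0 Hz; set s2 := z 0 2 ^+ 2 + z 0 3 ^+ 2.
have s01 : z 0 0 ^+ 2 + z 0 1 ^+ 2 = s2 by move: Qz; rewrite /Q /s2; lra.
have s2_ge0 : 0 <= s2 by rewrite addr_ge0 ?sqr_ge0.
have s2_gt0 : 0 < s2.
  rewrite lt_neqAle s2_ge0 andbT eq_sym; apply/eqP => s20; move/eqP: z0; apply.
  have h0 := sqr_ge0 (z 0 0); have h1 := sqr_ge0 (z 0 1).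
  have h2 := sqr_ge0 (z 0 2); have h3 := sqr_ge0 (z 0 3).
  move: s20 s01; rewrite /s2 => s20 s01.
  by apply: rV4P; rewrite mxE; apply/eqP; rewrite -sqrf_eq0; apply/eqP; lra.
set r := Num.sqrt s2; have r0 : 0 < r by rewrite sqrtr_gt0.
have rE : r ^+ 2 = s2 by rewrite sqr_sqrtr.
have [|t [tl ct st]] := @circle_param (z 0 2 / r) (z 0 3 / r).
  by rewrite !expr_div_n -mulrDl rE divff// gt_eqF.
have z2 : z 0 2 = r * cos t by rewrite ct mulrC divfK// gt_eqF.
have z3 : z 0 3 = r * sin t by rewrite st mulrC divfK// gt_eqF.
have := Hz t tl; rewrite /tden z2 z3.
have -> : z 0 0 * cos (phi t) + z 0 1 * sin (phi t) - r * cos t * cos t -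
    r * sin t * sin t = z 0 0 * cos (phi t) + z 0 1 * sin (phi t) -
    r * (cos t ^+ 2 + sin t ^+ 2) by ring.
rewrite cos2Dsin2 mulr1 => D0.
have eq0 : (z 0 0 - r * cos (phi t)) ^+ 2 + (z 0 1 - r * sin (phi t)) ^+ 2 <= 0.
  have -> : (z 0 0 - r * cos (phi t)) ^+ 2 + (z 0 1 - r * sin (phi t)) ^+ 2 =
    (z 0 0 ^+ 2 + z 0 1 ^+ 2) + r ^+ 2 * (cos (phi t) ^+ 2 + sin (phi t) ^+ 2) -
    2 * r * (z 0 0 * cos (phi t) + z 0 1 * sin (phi t)) by ring.
  by rewrite cos2Dsin2 mulr1 s01 -rE; nra.
have h0 := sqr_ge0 (z 0 0 - r * cos (phi t)).
have h1 := sqr_ge0 (z 0 1 - r * sin (phi t)).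
exists t, r; split => //; apply: rV4P; rewrite mxE /ideal_point vec4E//.
  by apply/eqP; rewrite -subr_eq0 -sqrf_eq0; apply/eqP; lra.
by apply/eqP; rewrite -subr_eq0 -sqrf_eq0; apply/eqP; lra.
Qed.

(** A linear form positive on the surface stays nonnegative at limits of its rays; the divisor 4 in
    the proof is the constant of [den_le]. *)
Lemma closure_tden (z : @nonzero R) t : 0 <= t <= 9 ->
  closure (rays_of (surf phi)) (\pi_(rays R) z) -> 0 <= tden phi t (val z).
Proof.
move=> tl /closure_raysP H; rewrite leNgt; apply/negP => D0.
have e0 : 0 < - tden phi t (val z) / 4 by rewrite divr_gt0// oppr_gt0.
have [x [s [[_ xO _] _ s0 zx]]] := H _ e0.
have Dx : 0 < tden phi t (s *: x).
  have := linear_den phi t s x 0; rewrite addr0 => ->.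
  have -> : tden phi t 0 = 0 by rewrite /tden !mxE; ring.
  by rewrite addr0 mulr_gt0//; exact: xO.
have DB : tden phi t (val z - s *: x) = tden phi t (val z) - tden phi t (s *: x).
  by rewrite /tden !mxE; ring.
have := den_le phi t (val z - s *: x); rewrite DB ler_norml; lra.
Qed.

Lemma norm_vec4_le (a b c d e : R) : 0 <= e ->
  `|a| <= e -> `|b| <= e -> `|c| <= e -> `|d| <= e -> `|vec4 a b c d| <= e.
Proof.
move=> e0 ae be ce de; rewrite /Num.norm/= mx_normrE.
apply: bigmax_le => // -[i j] _ /=; rewrite (ord1 i).
by move: j; apply: forall_ord4; rewrite vec4E.
Qed.

(** The approximating surface point lies over [(k cos t, k sin t)] and is scaled by [1 / r]. For
    large [k] its distance to the boundary point at angle [t] is small, and [invis] forces its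
    height close to [phi t]. *)
Lemma ideal_point_closure (z : @nonzero R) t : 0 <= t <= 9 -> val z = ideal_point t ->
  closure (rays_of (surf phi)) (\pi_(rays R) z).
Proof.
move=> tl zt; apply/closure_raysP => e e0.
(* Chosen so that [1 / k <= e / 2], for the last two coordinates, and [2 / k <= (e / 2) ^+ 2], for
   the chord between the angles [h] and [phi t], whose square is at most [2 / k]. *)
pose k : R := 1 + 2 / e + 8 / e ^+ 2.
have q1 : 0 < 2 / e by rewrite divr_gt0.
have q2 : 0 < 8 / e ^+ 2 by rewrite divr_gt0// exprn_gt0.
have k0 : 0 < k by rewrite /k; lra.
set a := k * cos t; set b := k * sin t; set r := ads_radius a b.
have r0 : 0 < r := radius_gt0 a b.
have r2 : r ^+ 2 = 1 + k ^+ 2.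
  rewrite sqr_radius /a /b.
  by transitivity (1 + k ^+ 2 * (cos t ^+ 2 + sin t ^+ 2)); [ring|rewrite cos2Dsin2 mulr1].
have kr : k < r by nra.
have cdE : cosdist a b t = k / r.
  rewrite /cosdist -/r /a /b; congr (_ / _).
  by transitivity (k * (cos t ^+ 2 + sin t ^+ 2)); [ring|rewrite cos2Dsin2 mulr1].
have kr1 : 1 - k / r <= k^-1.
  have -> : 1 - k / r = (r - k) / r by rewrite mulrBl divff// gt_eqF.
  rewrite ler_pdivrMr// mulrC ler_pdivlMr//.
  by nra.
set h := height gphi (a, b).
have hinv : invis phi a b h := invis_height gphi (a, b).
have chp := cos_gt_cosdist (hinv t tl); rewrite cdE in chp.
have kV : k^-1 <= e / 2.
  rewrite -[leRHS]invrK lef_pV2 ?posrE ?invr_gt0 ?divr_gt0// invf_div /k; lra.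
have kV2 : 2 * k^-1 <= (e / 2) ^+ 2.
  rewrite -ler_pdivlMl// -[leRHS]invrK lef_pV2 ?posrE ?invr_gt0 ?mulr_gt0 ?exprn_gt0 ?divr_gt0//.
  rewrite (_ : (2^-1 * (e / 2) ^+ 2)^-1 = 8 / e ^+ 2) /k; first by lra.
  by field; rewrite gt_eqF.
have ang : (cos (phi t) - cos h) ^+ 2 + (sin (phi t) - sin h) ^+ 2 <= (e / 2) ^+ 2.
  have -> : (cos (phi t) - cos h) ^+ 2 + (sin (phi t) - sin h) ^+ 2 =
    (cos (phi t) ^+ 2 + sin (phi t) ^+ 2) + (cos h ^+ 2 + sin h ^+ 2) -
    2 * cos (h - phi t) by rewrite cosB; ring.
  by rewrite !cos2Dsin2; apply: le_trans kV2; lra.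
have e2 : 0 <= e / 2 by rewrite divr_ge0// ltW.
have sqle (x : R) : x ^+ 2 <= (e / 2) ^+ 2 -> `|x| <= e / 2.
  by rewrite -[x ^+ 2](real_normK (num_real x)) ler_sqr ?nnegrE.
have s1 := sqr_ge0 (cos (phi t) - cos h); have s2 := sqr_ge0 (sin (phi t) - sin h).
exists (section gphi (a, b)), r^-1; split.
- exact: surf_section.
- apply/eqP => S0; have [] := surf_section gphi (a, b).
  by rewrite S0 /Q !mxE expr0n/= oppr0 !addr0 => /eqP; rewrite eq_sym oppr_eq0 oner_eq0.
- by rewrite invr_gt0.
rewrite zt; apply: (@le_lt_trans _ _ (e / 2)); last by rewrite ltr_pdivrMr// ltr_pMr// ltr1n.
have -> : ideal_point t - r^-1 *: section gphi (a, b) =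
  vec4 (cos (phi t) - cos h) (sin (phi t) - sin h)
       (cos t * (1 - k / r)) (sin t * (1 - k / r)).
  have rn : r != 0 by rewrite gt_eqF.
  by apply: rV4P; rewrite !mxE /ideal_point /section /cov ?vec4E -/r -/h /= /a /b /=; field.
have kr0 : 0 <= 1 - k / r by rewrite subr_ge0 ler_pdivrMr// mul1r ltW.
apply: norm_vec4_le => //.
- by apply: sqle; lra.
- by apply: sqle; lra.
- rewrite normrM (ger0_norm kr0) -[leRHS]mul1r; apply: ler_pM => //; first exact: cos_max.
  exact: le_trans kr1 kV.
- rewrite normrM (ger0_norm kr0) -[leRHS]mul1r; apply: ler_pM => //; first exact: sin_max.
  exact: le_trans kr1 kV.
Qed.

Lemma ideal_point_neq0 t : ideal_point t != 0.
Proof.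
apply/eqP => H; have := cos2Dsin2 t.
have := vec4E2 (cos (phi t)) (sin (phi t)) (cos t) (sin t).
have := vec4E3 (cos (phi t)) (sin (phi t)) (cos t) (sin t).
rewrite -/(ideal_point t) H !mxE => <- <-; rewrite expr0n/= addr0 => /eqP.
by rewrite eq_sym oner_eq0.
Qed.

Lemma ideal_boundary_surf :
  ideal_boundary (surf phi) = rays_of [set y | exists2 t, 0 <= t <= 9 & y = ideal_point t].
Proof.
apply/seteqP; split=> r.
  move=> [[cr _] [z /= Qz zr]]; rewrite -zr in cr *.
  have [t [s [tl s0 zE]]] := tden_ideal_point Qz (nonzero_neq0 z)
    (fun t tl => closure_tden tl cr).
  have [w wE] := nonzeroP (ideal_point_neq0 t).
  exists w; first by exists t.
  by apply/pi_raysP; exists s; rewrite // wE.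
move=> [z /= [t tl zt] <-].
have Ez : Ein2 (\pi_(rays R) z) by exists z; rewrite //= zt Q_ideal_point.
by split=> //; split; [exact: ideal_point_closure zt|right].
Qed.

End IdealBoundary.

(** * From achronal circles to functions on the line *)

Section Lift.
Context {R : realType}.
Local Open Scope quotient_scope.
Implicit Types (f : 'rV[R]_3 -> R) (s t : R) (p q : 'rV[R]_3).

Definition circle_point t : 'rV[R]_3 := \row_(i < 3) [:: cos t; sin t; 0]`_i.

Lemma dot_circle_point s t : dot (circle_point s) (circle_point t) = cos (s - t).
Proof. by rewrite /dot !big_ord_recl big_ord0 !mxE /= cosB mulr0 !addr0. Qed.

Lemma bdisc_circle_point t : bdisc (circle_point t).
Proof.
by split; [rewrite /sphere2/= dot_circle_point subrr cos0|rewrite mxE].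
Qed.

Lemma bdiscN p : bdisc p -> bdisc (- p).
Proof.
move=> [pp p2]; split; last by rewrite mxE p2 oppr0.
by rewrite /sphere2/= -pp /dot; apply: eq_bigr => i _; rewrite mxE mulrNN.
Qed.

Lemma bdisc_param p : bdisc p -> exists t, 0 <= t <= 9 /\ p = circle_point t.
Proof.
move=> [pp p2].
have p2' : p 0 (lift ord0 (lift ord0 ord0)) = 0.
  by rewrite -[RHS]p2; congr (p _ _); exact: val_inj.
have [|t [tl ct st]] := @circle_param R (p 0 ord0) (p 0 (lift ord0 ord0)).
  move: pp; rewrite /sphere2/= /dot !big_ord_recl big_ord0 p2' mulr0 !addr0.
  by rewrite !expr2.
exists t; split => //; apply/rowP; case=> -[|[|[|//]]] i3; rewrite mxE/=.
- by rewrite ct; congr (p _ _); exact: val_inj.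
- by rewrite st; congr (p _ _); exact: val_inj.
- by rewrite -[RHS]p2; congr (p _ _); exact: val_inj.
Qed.

Definition lift_of f t : R := f (circle_point t).

(** If the difference of two values reached [pi], the Lipschitz bound would force
    [cos (s - t) = -1]; the two points would be antipodal and the graph would contain an opposite
    pair. *)
Lemma lift_of_generic f : lipschitz1 f -> ~ pure_lightlike (circle_of f) ->
  generic_lift (lift_of f).
Proof.
move=> lf nf s t.
have H := lf _ _ (bdisc_circle_point s) (bdisc_circle_point t).
rewrite /sphere_dist dot_circle_point in H; split=> //.
have cst1 : -1 <= cos (s - t) <= 1 by rewrite cos_geN1 cos_le1.
rewrite lt_neqAle (le_trans H (acos_lepi cst1)) andbT; apply/eqP => E; apply: nf.
have cN1 : cos (s - t) = -1.
  apply/eqP; rewrite eq_le cos_geN1 andbT leNgt; apply/negP => c1.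
  by have := acos_ltpi (x := cos (s - t)); rewrite c1 cos_le1 => /(_ isT); rewrite ltNge -E H.
have sN0 : sin (s - t) = 0.
  by apply/eqP; rewrite -sqrf_eq0 sin2cos2 cN1 sqrrN expr1n subrr.
have sN : circle_point s = - circle_point t.
  have cs : cos s = - cos t.
    by rewrite -[in LHS](subrK t s) cosD cN1 sN0; ring.
  have ss : sin s = - sin t.
    by rewrite -[in LHS](subrK t s) sinD cN1 sN0; ring.
  by apply/rowP => i; rewrite !mxE cs ss; case: i => -[|[|[|//]]] i3 //=; rewrite oppr0.
exists f; split => //.
(* The opposite pair has to start from the point with the lower value of [f]. *)
have [st|st] := leP (f (circle_point t)) (f (circle_point s)).
  exists (circle_point t), (f (circle_point t)); split.
    by split=> //; exact: bdisc_circle_point.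
  split; first exact/bdiscN/bdisc_circle_point.
  by rewrite /= -sN -E ger0_norm ?subr_ge0// addrC subrK.
exists (circle_point s), (f (circle_point s)); split.
  by split=> //; exact: bdisc_circle_point.
split; first exact/bdiscN/bdisc_circle_point.
have -> : - circle_point s = circle_point t by rewrite sN opprK.
by rewrite /= -E ltr0_norm ?subr_lt0// opprB addrC subrK.
Qed.

Lemma circle_of_lift f :
  circle_of f = rays_of [set y | exists2 t, 0 <= t <= 9 & y = ideal_point (lift_of f) t].
Proof.
have cE t : cover_vec (circle_point t, f (circle_point t)) = ideal_point (lift_of f) t.
  by apply: rV4P; rewrite /ideal_point vec4E /cover_vec mxE /= ?mxE.
rewrite /circle_of; congr rays_of; apply/seteqP; split=> y /=.
  move=> [[p x] [/= /bdisc_param[t [tl ->]] ->] <-].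
  by exists t.
move=> [t tl ->]; exists (circle_point t, f (circle_point t)) => //.
by split=> //; exact: bdisc_circle_point.
Qed.

End Lift.

Theorem proposition8p23 (R : realType) (L : set (rays R)) (hL : generic_achronal_circle L) :
  exists S : set 'rV[R]_4,
    [/\ hypersurface S, spacelike S & ideal_boundary S = L].
Proof.
have [[f lf LE] nL] := hL; rewrite LE in nL *.
have gphi := lift_of_generic lf nL.
have cphi := continuous_generic_lift gphi.
exists (surf (lift_of f)); split.
- split; [by move=> y []|exact: submanifold_surf|exact: closed_surf|exact: connected_surf].
- exact: spacelike_surf.
- by rewrite ideal_boundary_surf// circle_of_lift.
Qed.
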